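(* Let $E$ be a directed graph and $K$ a field. The unique $K$-algebra homomorphism $\varphi: L_K(E)\to D(X)\rtimes_\alpha\mathbb{F}$ satisfying $\varphi(e)=1_e\delta_e$ and $\varphi(e^* )=1_{e^{-1}}\delta_{e^{-1}}$ for all $e\in E^1$, and $\varphi(v)=1_v\delta_0$ for all $v\in E^0$ (such a homomorphism exists), is an isomorphism of $K$-algebras.
   Context: **Graph.** $E=(E^0,E^1,r,s)$ is a directed graph with vertex set $E^0$, edge set $E^1$, and range and source maps $r,s:E^1\to E^0$ (no finiteness assumption). A sink is a vertex $v$ with $s^{-1}(v)=\emptyset$. $W$ is the set of finite paths of length at least $1$: words $\xi_1\cdots\xi_n$, $n\ge 1$, $\xi_i\in E^1$, $r(\xi_i)=s(\xi_{i+1})$. $W^\infty$ is the set of infinite paths $\xi_1\xi_2\xi_3\cdots$, $r(\xi_i)=s(\xi_{i+1})$ for all $i$. Extend $s(\xi)=s(\xi_1)$ for $\xi\in W\cup W^\infty$, $r(\xi_1\cdots\xi_n)=r(\xi_n)$, and $r(v)=s(v)=v$ for $v\in E^0$. $|a|$ is the length of $a\in W$. **Sets.** $\mathbb{F}$ is the free group generated by $E^1$, with neutral element denoted $0$; $W$ is viewed as a subset of $\mathbb{F}$. Let $X=\{\xi\in W: r(\xi)\text{ is a sink}\}\cup\{v\in E^0: v\text{ is a sink}\}\cup W^\infty$. Define $X_0=X$; for $b\in W$, $X_{b^{-1}}=\{\xi\in X: s(\xi)=r(b)\}$; for $a\in W$, $X_a=\{\xi\in X:\xi_1\cdots\xi_{|a|}=a\}$;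 for $a,b\in W$ with $r(a)=r(b)$ and $ab^{-1}$ reduced (i.e. $a_{|a|}\ne b_{|b|}$), $X_{ab^{-1}}=X_a$; and $X_c=\emptyset$ for all other $c\in\mathbb{F}$. For $v\in E^0$, $X_v=\{\xi\in X:s(\xi)=v\}$. **Partial action on $X$.** $\theta_0=\mathrm{id}_X$; for $b\in W$, $\theta_b:X_{b^{-1}}\to X_b$, $\theta_b(\xi)=b\xi$ (with $b\,r(b)=b$ when $r(b)$ is a sink), and $\theta_{b^{-1}}=\theta_b^{-1}$; for $a,b\in W$ with $r(a)=r(b)$, $a_{|a|}\neq b_{|b|}$, $\theta_{ab^{-1}}:X_{ba^{-1}}\to X_{ab^{-1}}$, $\theta_{ab^{-1}}(\xi)=a\xi_{|b|+1}\xi_{|b|+2}\cdots$; otherwise $\theta_c$ is the empty map. **Algebras.** $F(X)$ is the $K$-algebra of functions $X\to K$ with pointwise operations; $F(X_c)$ is the ideal of functions vanishing outside $X_c$; $\alpha_c:F(X_{c^{-1}})\to F(X_c)$ is $\alpha_c(f)=f\circ\theta_{c^{-1}}$ (extended by zero outside $X_c$). $1_c$ and $1_v$ are the characteristic functions of $X_c$ ($c\in\mathbb{F}$) and $X_v$ ($v\in E^0$). Let $D(X)=D_0$ be the $K$-linear span of $\{1_p:p\in\mathbb{F}\setminus\{0\}\}\cup\{1_v:v\in E^0\}$, and for $p\in\mathbb{F}\setminus\{0\}$ let $D_p=1_pD_0$, the $K$-linear span of $\{1_p1_q:q\in\mathbb{F}\}$. Each $\alpha_p$ restricts to an isomorphism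 $D_{p^{-1}}\to D_p$, giving a partial action of $\mathbb{F}$ on $D_0$. **Partial skew group ring.** $D(X)\rtimes_\alpha\mathbb{F}$ is the $K$-algebra of finite formal sums $\sum_{p\in\mathbb{F}}a_p\delta_p$ with $a_p\in D_p$, with componentwise linear structure and product determined by $(a_p\delta_p)(b_q\delta_q)=\alpha_p(\alpha_{p^{-1}}(a_p)b_q)\delta_{pq}$. **Leavitt path algebra.** $L_K(E)$ is the universal (not necessarily unital) $K$-algebra generated by pairwise orthogonal idempotents $\{v:v\in E^0\}$ and elements $\{e,e^*:e\in E^1\}$ subject to: (1) $s(e)e=er(e)=e$ for all $e\in E^1$; (2) $r(e)e^*=e^*s(e)=e^*$ for all $e\in E^1$; (3) $e^*f=0$ if $e\ne f$ and $e^*e=r(e)$, for all $e,f\in E^1$; (4) $v=\sum_{e\in E^1:s(e)=v}ee^*$ for each vertex $v$ with $0<\#\{e:s(e)=v\}<\infty$. Homomorphisms of $K$-algebras are not required to be unital. *)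

(* Defs.v *)
From HB Require Import structures.
From mathcomp Require Import all_boot all_order all_algebra generic_quotient.
From mathcomp Require Import finmap.
From mathcomp Require Import boolp classical_sets functions cardinality fsbigop numfun.

Set Implicit Arguments.
Unset Strict Implicit.
Unset Printing Implicit Defensive.

Import GRing.Theory.

Local Open Scope classical_set_scope.
Local Open Scope quotient_scope.
Local Open Scope ring_scope.

Section FreeGroup.
Variable T : choiceType.

(* The letter (x, true) stands for the generator x, (x, false) for x^-1. *)
Definition linv (l : T * bool) : T * bool := (l.1, ~~ l.2).

Definition noncancel (k l : T * bool) : bool := l != linv k.

Definition reduced (w : seq (T * bool)) : bool := sorted noncancel w.

Record free_group := FreeGroup { word : seq (T * bool); _ : reduced word }.

HB.instance Definition _ := [isSub for word].
HB.instance Definition _ := [Choice of free_group by <:].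

Definition wcons (l : T * bool) (w : seq (T * bool)) : seq (T * bool) :=
  if w is k :: w' then if k == linv l then w' else l :: w else [:: l].

Definition wcat (u v : seq (T * bool)) : seq (T * bool) := foldr wcons v u.

Definition winv (w : seq (T * bool)) : seq (T * bool) := rev (map linv w).

Lemma linvK : involutive linv.
Proof. by case=> x b; rewrite /linv /= negbK. Qed.

Lemma reduced_tl l w : reduced (l :: w) -> reduced w.
Proof. by move/path_sorted. Qed.

Lemma wcons_reduced l w : reduced w -> reduced (wcons l w).
Proof.
case: w => [|k w] //= hw; case: ifP => hk; first exact: path_sorted hw.
by rewrite /= {1}/noncancel hk.
Qed.

Lemma wcat_reduced u v : reduced v -> reduced (wcat u v).
Proof. by move=> hv; elim: u => //= l u; exact: wcons_reduced. Qed.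

Lemma winv_reduced w : reduced w -> reduced (winv w).
Proof.
rewrite /reduced /winv rev_sorted sorted_map.
apply: sub_sorted => k l; apply: contra => /eqP /(can_inj linvK) ->.
by rewrite linvK.
Qed.

Lemma wconsK l w : reduced w -> wcons l (wcons (linv l) w) = w.
Proof.
case: w => [_|k w] /=; first by rewrite eqxx.
case: ifP => [/eqP ->|hk]; last by rewrite /= eqxx.
rewrite linvK; case: w => [|m w] //= /andP[].
by rewrite /noncancel => /negbTE ->.
Qed.

Lemma wcons_noncancel l w : reduced (l :: w) -> wcons l w = l :: w.
Proof. by case: w => [|k w] //= /andP[/negbTE ->]. Qed.

Lemma wcat_w0 w : reduced w -> wcat w [::] = w.
Proof.
elim: w => //= l w IH hw; rewrite IH ?wcons_noncancel //.
exact: reduced_tl hw.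
Qed.

Lemma wcat_wcons l u w : reduced w -> wcat (wcons l u) w = wcons l (wcat u w).
Proof.
move=> hw; case: u => [|k u] //=; case: ifP => [/eqP ->|] //.
by rewrite wconsK //; apply: wcat_reduced.
Qed.

Lemma wcatA u v w : reduced w -> wcat u (wcat v w) = wcat (wcat u v) w.
Proof. by move=> hw; elim: u => //= l u ->; rewrite wcat_wcons. Qed.

Lemma wcat_cat u v w : wcat (u ++ v) w = wcat u (wcat v w).
Proof. by rewrite /wcat foldr_cat. Qed.

Lemma winv_cons l w : winv (l :: w) = rcons (winv w) (linv l).
Proof. by rewrite /winv /= rev_cons. Qed.

Lemma wcat_invl w v : reduced v -> wcat (winv w) (wcat w v) = v.
Proof.
elim: w v => //= l w IH v hv; rewrite winv_cons -cats1 wcat_cat /=.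
by rewrite -{2}(linvK l) wconsK ?IH // wcat_reduced.
Qed.

Definition fg_one : free_group := @FreeGroup [::] isT.
Definition fg_mul (p q : free_group) : free_group :=
  FreeGroup (wcat_reduced (word p) (valP q)).
Definition fg_inv (p : free_group) : free_group :=
  FreeGroup (winv_reduced (valP p)).

Lemma fg_mulA : associative fg_mul.
Proof. by move=> p q r; apply: val_inj; apply: wcatA; apply: (valP r). Qed.

Lemma fg_mul1 : left_id fg_one fg_mul.
Proof. by move=> p; apply: val_inj. Qed.

Lemma fg_mulr1 : right_id fg_one fg_mul.
Proof. by move=> p; apply: val_inj; apply: wcat_w0; apply: (valP p). Qed.

Lemma winvK : involutive winv.
Proof.
move=> w; rewrite /winv map_rev revK -map_comp; under eq_map do rewrite /= linvK.
exact: map_id.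
Qed.

Lemma fg_invl : left_inverse fg_one fg_inv fg_mul.
Proof.
move=> p; apply: val_inj => /=.
by rewrite -{2}(wcat_w0 (valP p)) wcat_invl.
Qed.

Lemma fg_invr : right_inverse fg_one fg_inv fg_mul.
Proof.
move=> p; rewrite -{1}[p](_ : fg_inv (fg_inv p) = p) ?fg_invl //.
by apply: val_inj; rewrite /= winvK.
Qed.

HB.instance Definition _ := isGroup.Build free_group
  fg_mulA fg_mul1 fg_mulr1 fg_invl fg_invr.

Definition gen (x : T) : free_group := @FreeGroup [:: (x, true)] isT.

End FreeGroup.

Record digraph := Digraph {
  vertex : choiceType;
  edge : choiceType;
  src : edge -> vertex;
  tgt : edge -> vertex }.

Section BoundaryPaths.
Variable E : digraph.
Implicit Types (e f : edge E) (a b : seq (edge E)).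

Definition sink (v : vertex E) : Prop := forall e, src e <> v.

Definition link e f : bool := tgt e == src f.

(* Fin v w is the finite path w starting at v; it has length 0, and then is
   the vertex v itself, when w is empty. *)
Inductive bword := Fin of vertex E & seq (edge E) | Inf of nat -> edge E.

Fixpoint walk_to_sink (v : vertex E) (w : seq (edge E)) : Prop :=
  if w is e :: w' then src e = v /\ walk_to_sink (tgt e) w' else sink v.

Definition is_boundary (x : bword) : Prop :=
  match x with
  | Fin v w => walk_to_sink v w
  | Inf g => forall i, link (g i) (g i.+1)
  end.

Record boundary := Boundary { bval : bword; _ : `[< is_boundary bval >] }.

HB.instance Definition _ := [isSub for bval].

Definition bsrc (x : bword) : vertex E :=
  match x with Fin v _ => v | Inf g => src (g 0%N) end.

Definition bhead (x : bword) : option (edge E) :=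
  match x with Fin _ w => ohead w | Inf g => Some (g 0%N) end.

Definition bbehead (x : bword) : bword :=
  match x with
  | Fin v [::] => Fin v [::]
  | Fin _ (e :: w) => Fin (tgt e) w
  | Inf g => Inf (fun i => g i.+1)
  end.

Definition bcons e (x : bword) : bword :=
  match x with
  | Fin _ w => Fin (src e) (e :: w)
  | Inf g => Inf (fun i => if i is j.+1 then g j else e)
  end.

Definition bcat a (x : bword) : bword := foldr bcons x a.

Definition bdrop n (x : bword) : bword := iter n bbehead x.

Fixpoint starts a (x : bword) : bool :=
  if a is e :: a' then (bhead x == Some e) && starts a' (bbehead x) else true.

(* posneg w = Some (a, b) when w spells a b^-1 with a and b words in the edges
   (see posnegP), and None when w is not of this form. *)
Fixpoint posneg (w : seq (edge E * bool)) : option (seq (edge E) * seq (edge E)) :=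
  match w with
  | [::] => Some ([::], [::])
  | (e, true) :: w' => if posneg w' is Some (a, b) then Some (e :: a, b) else None
  | (e, false) :: w' =>
      if posneg w' is Some ([::], b) then Some ([::], rcons b e) else None
  end.

Definition X_ (c : free_group (edge E)) : set boundary :=
  match posneg (word c) with
  | Some ([::], [::]) => setT
  | Some ([::], f :: b) =>
      if path link f b then [set x | bsrc (bval x) = tgt (last f b)] else set0
  | Some (e :: a, [::]) =>
      if path link e a then [set x | starts (e :: a) (bval x)] else set0
  | Some (e :: a, f :: b) =>
      if [&& path link e a, path link f b & tgt (last e a) == tgt (last f b)]
      then [set x | starts (e :: a) (bval x)] else set0
  | None => set0
  end.

Definition Xv (v : vertex E) : set boundary := [set x | bsrc (bval x) = v].

(* For c = a b^-1 this removes the prefix b and then prepends a, on the domain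
   X_(c^-1); a and b may be empty, which covers theta_0, theta_a and
   theta_(b^-1). By thetaV, theta_(c^-1) is the inverse of theta_c. *)
Definition theta (c : free_group (edge E)) (x : boundary) : option boundary :=
  if posneg (word c) is Some (a, b) then
    if `[< X_ c^-1%g x >] then insub (bcat a (bdrop (size b) (bval x))) else None
  else None.

Definition posw a : seq (edge E * bool) := [seq (e, true) | e <- a].
Definition negw b : seq (edge E * bool) := [seq (e, false) | e <- rev b].

Lemma posnegP w a b : posneg w = Some (a, b) <-> w = posw a ++ negw b.
Proof.
split.
  elim: w a b => [|[e [|]] w IH] a b /=; first by case=> <- <-.
    by case: posneg IH => [[a' b']|] // /(_ _ _ erefl) -> [<- <-].
  case: posneg IH => [[[|//] b']|] // /(_ _ _ erefl) -> [<- <-].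
  by rewrite /negw rev_rcons.
move=> ->; elim: a => [|e a /= -> //]; rewrite /=.
elim/last_ind: b => [|b e IH] //; rewrite /negw rev_rcons /=.
by rewrite /negw in IH; rewrite IH.
Qed.

Lemma winv_posneg a b : winv (posw a ++ negw b) = posw b ++ negw a.
Proof.
rewrite /winv map_cat rev_cat /posw /negw -!map_comp -!map_rev revK.
by congr (_ ++ _); apply: eq_map.
Qed.

Lemma posneg_winv w a b : posneg w = Some (a, b) -> posneg (winv w) = Some (b, a).
Proof. by move/posnegP ->; apply/posnegP; apply: winv_posneg. Qed.

(* The partial bijection attached to one letter. *)
Definition lact (l : edge E * bool) (x : boundary) : option boundary :=
  if l.2 then if bsrc (bval x) == tgt l.1 then insub (bcons l.1 (bval x)) else None
  else if bhead (bval x) == Some l.1 then insub (bbehead (bval x)) else None.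

Definition wact w (x : boundary) : option boundary :=
  foldr (fun l => obind (lact l)) (Some x) w.

Lemma bvalP (x : boundary) : is_boundary (bval x).
Proof. by apply/asboolP; apply: (valP x). Qed.

Lemma bcons_boundary e (x : bword) :
  is_boundary x -> bsrc x = tgt e -> is_boundary (bcons e x).
Proof.
case: x => [v w|g] /= h hv; first by rewrite -hv.
by case=> [|i] /=; rewrite /link ?hv //; apply: h.
Qed.

Lemma bbehead_boundary (x : bword) : is_boundary x -> is_boundary (bbehead x).
Proof. by case: x => [v [|e w]|g] //= []. Qed.

Lemma bconsK e (x : bword) : is_boundary x -> bsrc x = tgt e ->
  bbehead (bcons e x) = x.
Proof. by case: x => [v w|g] //= _ ->. Qed.

Lemma bhead_cons e (x : bword) : bhead (bcons e x) = Some e.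
Proof. by case: x. Qed.

Lemma bsrc_cons e (x : bword) : bsrc (bcons e x) = src e.
Proof. by case: x. Qed.

Lemma bsrc_head (x : bword) e : is_boundary x -> bhead x = Some e ->
  bsrc x = src e.
Proof. by case: x => [v [|f w]|g] //= => [[<- _]|_] [->]. Qed.

Lemma bsrc_behead (x : bword) e : is_boundary x -> bhead x = Some e ->
  bsrc (bbehead x) = tgt e.
Proof.
case: x => [v [|f w]|g] //= h [<-] //.
by have /eqP -> := h 0%N.
Qed.

Lemma bbeheadK (x : bword) e : is_boundary x -> bhead x = Some e ->
  bcons e (bbehead x) = x.
Proof.
case: x => [v [|f w]|g] //= h [<-]; first by case: h => ->.
by congr Inf; apply: funext; case.
Qed.

Lemma lact_posP e x y : lact (e, true) x = Some y <->
  bsrc (bval x) = tgt e /\ bval y = bcons e (bval x).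
Proof.
rewrite /lact /=; split.
  case: eqP => // h; case: insubP => // z _ hz [<-]; split=> //.
case=> h hy; rewrite h eqxx -hy; exact: valK.
Qed.

Lemma lact_negP e x y : lact (e, false) x = Some y <->
  bhead (bval x) = Some e /\ bval y = bbehead (bval x).
Proof.
rewrite /lact /=; split.
  case: eqP => // h; case: insubP => // z _ hz [<-]; split=> //.
case=> h hy; rewrite h eqxx -hy; exact: valK.
Qed.

Lemma lact_pos e (x : boundary) : bsrc (bval x) = tgt e ->
  exists y, lact (e, true) x = Some y.
Proof.
move=> h; have h' := bcons_boundary (bvalP x) h.
exists (Boundary (asboolT h')).
exact/lact_posP.
Qed.

Lemma lact_neg e (x : boundary) : bhead (bval x) = Some e ->
  exists y, lact (e, false) x = Some y.
Proof.
move=> h; have h' := bbehead_boundary (bvalP x).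
exists (Boundary (asboolT h')).
exact/lact_negP.
Qed.

Lemma lactK l x y : lact l x = Some y -> lact (linv l) y = Some x.
Proof.
case: l => e [|]; rewrite /linv /=.
  move/lact_posP => [h hy]; apply/lact_negP; rewrite hy bhead_cons.
  by rewrite (bconsK (bvalP x) h).
move/lact_negP => [h hy]; apply/lact_posP; rewrite hy (bbeheadK (bvalP x) h).
by rewrite (bsrc_behead (bvalP x) h).
Qed.

Lemma wact_cat u v x : wact (u ++ v) x = obind (wact u) (wact v x).
Proof.
rewrite /wact foldr_cat -/(wact v x); case: (wact v x) => //=.
by elim: u => //= l u ->.
Qed.

Lemma wactK w x y : wact w x = Some y -> wact (winv w) y = Some x.
Proof.
elim: w y => [|l w IH] y /=; first by case=> ->.
rewrite winv_cons -cats1 wact_cat /=.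
case hw: (wact w x) => [z|] //= hl.
by rewrite (lactK hl) /=; apply: IH.
Qed.

Lemma wact_wcons l w x y : wact (l :: w) x = Some y -> wact (wcons l w) x = Some y.
Proof.
case: w => [|k w] //=; case: eqP => // -> .
case: (wact w x) => [z|] //=.
case hz: lact => [t|] //= ht.
by move/lactK: hz; rewrite linvK ht.
Qed.

Lemma wact_wcat u v x y z : wact v x = Some y -> wact u y = Some z ->
  wact (wcat u v) x = Some z.
Proof.
move=> hv; elim: u z => [|l u IH] z /=; first by case=> <-.
case hu: (wact u y) => [t|] //= hl; apply: wact_wcons => /=.
by rewrite (IH t).
Qed.

Lemma starts_rcons b e (x : bword) :
  starts (rcons b e) x = starts b x && (bhead (bdrop (size b) x) == Some e).
Proof.
elim: b x => [|f b IH] x /=; first by rewrite andbT.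
by rewrite IH -andbA /bdrop -iterSr.
Qed.

Lemma bdrop_boundary n (x : bword) : is_boundary x -> is_boundary (bdrop n x).
Proof. by move=> h; elim: n => //= n; exact: bbehead_boundary. Qed.

Lemma wact_negP b x y : wact (negw b) x = Some y <->
  starts b (bval x) /\ bval y = bdrop (size b) (bval x).
Proof.
elim/last_ind: b y => [|b e IH] y.
  by split=> [[->]|[_ /val_inj ->]].
rewrite /negw rev_rcons /= -/(negw b) starts_rcons size_rcons /=.
case hb: (wact (negw b) x) => [z|] /=.
  have [/(_ hb) [h1 h2] _] := IH z; rewrite lact_negP h1 h2 /=.
  by split=> [[-> ->]|[/eqP]].
split=> // -[/andP[h1 h2] _].
have h : is_boundary (bdrop (size b) (bval x)) by apply/bdrop_boundary/bvalP.
have [_ h3] := IH (Boundary (asboolT h)).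
by move: hb; rewrite h3.
Qed.

Lemma wact_posP e a x y : wact (posw (e :: a)) x = Some y <->
  [/\ path link e a, bsrc (bval x) = tgt (last e a) & bval y = bcat (e :: a) (bval x)].
Proof.
elim: a e y => [|f a IH] e y.
  rewrite /= lact_posP; split=> [[-> ->]|[_ -> ->]] //.
rewrite -[wact _ _]/(obind (lact (e, true)) (wact (posw (f :: a)) x)).
case ha: wact => [z|] /=.
  have [/(_ ha) [h1 h2 h3] _] := IH f z.
  rewrite lact_posP h3 [bcat _ _]/= bsrc_cons h1 h2 andbT /link.
  by split=> [[-> ->]|[/eqP-> _ ->]]; rewrite ?eqxx.
split=> // -[/andP[h1 h2] h3 h4].
have hb : is_boundary (bcat (f :: a) (bval x)).
  elim: (a) f h2 h3 {IH ha h1 h4} => [|g a' IH] f /= h2 h3.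
    by apply: bcons_boundary; rewrite ?h3 //; apply: bvalP.
  case/andP: h2 => /eqP h2 h2'; apply: bcons_boundary; first exact: IH.
  by rewrite bsrc_cons h2.
have [_ h5] := IH f (Boundary (asboolT hb)).
by move: ha; rewrite h5.
Qed.

Lemma wact_None w x : reduced w -> posneg w = None -> wact w x = None.
Proof.
elim: w => [|[e [|]] w IH] //= hw.
  by case: posneg IH => [[a b]|] // IH _; rewrite IH //; apply: reduced_tl hw.
have /IH {}IH := reduced_tl hw.
case hs: posneg IH => [[[|f a] b]|] // IH _; last by rewrite IH.
move/posnegP: hs hw => -> /=; rewrite -/(posw a) {1}/noncancel /linv /= => /andP[hfe _].
rewrite -[obind (lact (f, true)) _]/(wact ((f, true) :: posw a ++ negw b) x).
case h: wact => [z|] //=; move: h => /=.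
case: (wact (posw a ++ negw b) x) => //= t /lact_posP[_ ht].
rewrite /lact /= ht bhead_cons; case: eqP => // -[hf].
by rewrite hf eqxx in hfe.
Qed.

Lemma bsrc_drop f b x : starts (f :: b) (bval x) ->
  bsrc (bdrop (size (f :: b)) (bval x)) = tgt (last f b).
Proof.
elim/last_ind: b => [|b g IH].
  by rewrite /= andbT => /eqP h; rewrite (bsrc_behead (bvalP x) h).
rewrite -rcons_cons starts_rcons size_rcons last_rcons => /andP[h1 /eqP h2].
rewrite /bdrop iterS -/(bdrop _ _).
by rewrite (bsrc_behead (bdrop_boundary _ (bvalP x)) h2).
Qed.

Lemma starts_path f b (x : bword) : is_boundary x -> starts (f :: b) x ->
  path link f b.
Proof.
elim: b f x => [|g b IH] f x //= hx /and3P[/eqP h1 h2 h3].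
have hx' := bbehead_boundary hx.
rewrite (IH g (bbehead x)) //= ?h2 ?h3 // andbT.
by rewrite /link -(bsrc_behead hx h1) (bsrc_head hx' (eqP h2)).
Qed.

Lemma X_dom (c : free_group (edge E)) a b x : posneg (word c) = Some (a, b) ->
  X_ c^-1%g x <-> starts b (bval x) /\
    (if a is e :: a' then
       path link e a' /\ bsrc (bdrop (size b) (bval x)) = tgt (last e a')
     else True).
Proof.
move=> hs; rewrite /X_ [word _]/= (posneg_winv hs).
case: b {hs} => [|f b]; case: a => [|e a].
- by split.
- rewrite /=; case: ifP => h; first by split=> [|[_ []]].
  by split=> // -[_ []].
- case: ifP => h; first by split=> [|[]].
  by split=> // -[/(starts_path (bvalP x))]; rewrite h.
- case: ifP => h; split=> //.
  + case/and3P: h => h1 h2 /eqP h3 h; split=> //; split=> //.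
    by rewrite bsrc_drop.
  + by case.
  + case=> h1 [h2]; rewrite bsrc_drop // => h3.
    by move: h; rewrite h2 h3 eqxx (starts_path (bvalP x) h1).
Qed.

Lemma thetaE c x : theta c x = wact (word c) x.
Proof.
rewrite /theta; case hs: (posneg (word c)) => [[a b]|]; last first.
  by rewrite wact_None //; apply: (valP c).
have hd := X_dom x hs; move/posnegP: hs => hs; rewrite hs wact_cat.
case: asboolP => [/hd [h1 h2]|hX]; last first.
  case h: obind => [y|] //; case: hX; apply/hd.
  case hb: (wact (negw b) x) h => [z|] //=.
  move/wact_negP: hb => [h1 h2]; case: a {hs hd} => [|e a] // /wact_posP[h3 h4 h5].
  by rewrite -h2.
have h : is_boundary (bdrop (size b) (bval x)) by apply/bdrop_boundary/bvalP.
set z := Boundary (asboolT h).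
have -> : wact (negw b) x = Some z by apply/wact_negP.
rewrite -[bdrop _ _]/(bval z) [obind _ _]/=.
case: a {hs hd} h2 => [_|e a [h2 h3]]; first exact: valK.
have hb : is_boundary (bcat (e :: a) (bval z)).
  rewrite [size _]/= in h3.
  have : bsrc (bval z) = tgt (last e a) by [].
  elim: (a) e h2 {h3} => [|g a' IH] e /= h2 h3.
    by apply: bcons_boundary.
  case/andP: h2 => /eqP h2 h2'; apply: bcons_boundary; first exact: IH.
  by rewrite bsrc_cons h2.
have [_ ->] := wact_posP e a z (Boundary (asboolT hb)); first by rewrite -[bcat _ _]/(bval (Boundary (asboolT hb))) valK.
by split.
Qed.

Lemma theta1 x : theta 1%g x = Some x.
Proof. by rewrite thetaE. Qed.

Lemma thetaV c x y : theta c x = Some y -> theta c^-1%g y = Some x.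
Proof. by rewrite !thetaE; apply: wactK. Qed.

Lemma thetaM p q x y z : theta q x = Some y -> theta p y = Some z ->
  theta (p * q)%g x = Some z.
Proof. by rewrite !thetaE; apply: wact_wcat. Qed.

Lemma X_theta c x : X_ c x <-> exists y, theta c^-1%g x = Some y.
Proof.
split=> [h|[y]].
  have [[a b] hs] : exists ab, posneg (word c^-1%g) = Some ab.
    case hs: (posneg (word c^-1%g)) => [ab|]; first by exists ab.
    have : posneg (word c) = None.
      case hc: (posneg (word c)) => [[a b]|] //.
      by rewrite [word _]/= (posneg_winv hc) in hs.
    by move: h; rewrite /X_ => + hc; rewrite hc.
  have := X_dom x hs; rewrite invgK => -[/(_ h) [h1 h2] _].
  rewrite thetaE; move/posnegP: (hs) => ->; rewrite wact_cat.
  have hb : is_boundary (bdrop (size b) (bval x)) by apply/bdrop_boundary/bvalP.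
  have -> : wact (negw b) x = Some (Boundary (asboolT hb)) by apply/wact_negP.
  rewrite /=; case: a {hs} h2 => [_|e a [h2 h3]].
    by exists (Boundary (asboolT hb)).
  have hc : is_boundary (bcat (e :: a) (bdrop (size b) (bval x))).
    elim: (a) e h2 h3 => [|g a' IH] e /= h2 h3.
      by apply: bcons_boundary.
    case/andP: h2 => /eqP h2 h2'; apply: bcons_boundary; first exact: IH.
    by rewrite bsrc_cons h2.
  by exists (Boundary (asboolT hc)); apply/wact_posP.
rewrite /theta; case: (posneg _) => [[a b]|] //; rewrite invgK.
by case: asboolP.
Qed.

Lemma X_1 : X_ 1%g = setT.
Proof. by []. Qed.

End BoundaryPaths.

HB.mixin Record isNUAlgebra (K : pzRingType) A of GRing.Lmodule K A := {
  nmul : A -> A -> A;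
  nmulA : associative nmul;
  nmulDl : left_distributive nmul +%R;
  nmulDr : right_distributive nmul +%R;
  nmulZl : forall k x y, nmul (k *: x) y = k *: nmul x y;
  nmulZr : forall k x y, nmul x (k *: y) = k *: nmul x y }.

(* Associative K-algebras that need not have a unit. *)
#[short(type="nuAlgType")]
HB.structure Definition NUAlgebra (K : pzRingType) :=
  {A of isNUAlgebra K A & GRing.Lmodule K A}.

Definition nualg_hom (K : pzRingType) (A B : nuAlgType K) (f : A -> B) : Prop :=
  (forall (k : K) x y, f (k *: x + y) = k *: f x + f y) /\
  (forall x y, f (nmul x y) = nmul (f x) (f y)).

Section Span.
Variables (K : pzRingType) (V : lmodType K).

Definition lspan (S : set V) : set V :=
  [set x | exists (n : nat) (c : 'I_n -> K) (g : 'I_n -> V),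
     (forall i, S (g i)) /\ x = \sum_(i < n) c i *: g i].

Lemma lspan_ind (S P : set V) :
  P 0 -> (forall k x y, S x -> P y -> P (k *: x + y)) -> lspan S `<=` P.
Proof.
move=> P0 PS x [n [c [g [hg ->]]]].
elim: n c g hg => [|n IH] c g hg; first by rewrite big_ord0.
by rewrite big_ord_recl; apply: PS => //; apply: IH => i.
Qed.

Lemma lspan0 (S : set V) : lspan S 0.
Proof.
exists 0%N, (fun=> 0), (fun=> 0); split; first by case.
by rewrite big_ord0.
Qed.

Lemma lspan_cons (S : set V) k x y : S x -> lspan S y -> lspan S (k *: x + y).
Proof.
move=> Sx [n [c [g [hg ->]]]].
exists n.+1, (fun i => oapp c k (unlift ord0 i)), (fun i => oapp g x (unlift ord0 i)).
split=> [i|]; first by case: unliftP => [j _|_] /=.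
rewrite big_ord_recl unlift_none /=; congr (_ + _).
by apply: eq_bigr => i _; rewrite liftK.
Qed.

Lemma lspanD (S : set V) x y : lspan S x -> lspan S y -> lspan S (x + y).
Proof.
move=> hx hy; move: x hx; apply: lspan_ind; first by rewrite add0r.
by move=> k x z Sx hz /=; rewrite -addrA; apply: lspan_cons.
Qed.

Lemma lspanZ (S : set V) k x : lspan S x -> lspan S (k *: x).
Proof.
move: x; apply: lspan_ind => [|l x y Sx hy] /=; first by rewrite scaler0; apply: lspan0.
by rewrite scalerDr scalerA; apply: lspan_cons.
Qed.

Lemma lspan_gen (S : set V) x : S x -> lspan S x.
Proof. by move=> Sx; rewrite -[x]addr0 -[x]scale1r; apply: lspan_cons => //; apply: lspan0. Qed.

End Span.

Section SkewRing.
Variables (K : fieldType) (E : digraph).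
Implicit Types (p q r s : free_group (edge E)) (v : vertex E).

(* The algebra F(X); K^o is K seen as a module over itself. *)
Notation FX := (boundary E -> K^o).
Implicit Types f g h : FX.

Definition one_ p : FX := \1_(X_ p).
Definition onev v : FX := \1_(Xv v).

Definition alpha p f : FX :=
  fun x => if theta p^-1%g x is Some y then f y else 0.

Definition gens : set FX :=
  [set f | (exists2 p, p != 1%g & f = one_ p) \/ (exists v, f = onev v)].

Definition D0 : set FX := lspan gens.

(* For p = 1 this is D0, since one_ 1 is the constant function 1. *)
Definition D_ p : set FX := [set one_ p * f | f in D0].

Lemma one_E p x : one_ p x = (isSome (theta p^-1%g x))%:R.
Proof.
rewrite /one_ indicE; congr (nat_of_bool _)%:R.
apply/idP/idP; first by rewrite inE => /X_theta [y ->].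
by case h: theta => [y|] // _; rewrite inE; apply/X_theta; exists y.
Qed.

Lemma onevE v x : onev v x = (bsrc (bval x) == v)%:R.
Proof.
rewrite /onev indicE; congr (nat_of_bool _)%:R.
by apply/idP/idP; rewrite inE => /eqP.
Qed.

Lemma one_1 : one_ 1%g = 1.
Proof. by apply/funext => x; rewrite one_E invg1 theta1. Qed.

Lemma one_sqr p : one_ p * one_ p = one_ p.
Proof.
apply/funext => x; rewrite /GRing.mul /= one_E.
by case: isSome; rewrite ?mulr1 ?mulr0.
Qed.

Lemma alpha0 p : alpha p 0 = 0.
Proof. by apply/funext => x; rewrite /alpha; case: theta. Qed.

Lemma alphaD p f g : alpha p (f + g) = alpha p f + alpha p g.
Proof.
apply/funext => x; rewrite /alpha /GRing.add /=; case: theta => //.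
by rewrite addr0.
Qed.

Lemma alphaZ p k f : alpha p (k *: f) = k *: alpha p f.
Proof.
apply/funext => x; rewrite -[RHS]/(k *: (alpha p f x)) /alpha.
by case: theta => //; rewrite scaler0.
Qed.

Lemma alphaM p f g : alpha p (f * g) = alpha p f * alpha p g.
Proof.
apply/funext => x; rewrite /alpha /GRing.mul /=; case: theta => //.
by rewrite mulr0.
Qed.

Lemma alpha_one p q : alpha p (one_ q) = one_ p * one_ (p * q)%g.
Proof.
apply/funext => x; rewrite -[RHS]/(one_ p x * one_ (p * q)%g x) !one_E /alpha.
case h: (theta p^-1%g x) => [y|]; last by rewrite mul0r.
rewrite mul1r one_E; congr (nat_of_bool _)%:R; rewrite invgM.
apply/idP/idP.
  by case hy: (theta q^-1%g y) => [z|] // _; rewrite (thetaM h hy).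
case hx: theta => [z|] // _.
have := thetaM (thetaV h) hx; by rewrite mulgK => ->.
Qed.

Lemma alphaK p f : alpha p (alpha p^-1%g f) = one_ p * f.
Proof.
apply/funext => x; rewrite /alpha /GRing.mul /= one_E invgK.
case h: (theta p^-1%g x) => [y|]; last by rewrite mul0r.
by rewrite mul1r; move/thetaV: h; rewrite invgK => ->.
Qed.

Lemma alpha_supp p f : alpha p f = one_ p * alpha p f.
Proof.
apply/funext => x; rewrite /alpha /GRing.mul /= one_E.
by case: theta => [y|]; rewrite ?mul1r ?mul0r.
Qed.

(* Cylinder sets: X_c (c != 1) and Xv are empty or of this form. *)
Definition cyl v (a : seq (edge E)) : set (boundary E) :=
  [set x | bsrc (bval x) = v /\ starts a (bval x)].

Lemma starts_src e a (x : boundary E) : starts (e :: a) (bval x) -> bsrc (bval x) = src e.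
Proof. by case/andP => /eqP /(bsrc_head (bvalP x)). Qed.

Lemma X_cyl p : p != 1%g -> X_ p = set0 \/ exists v a, X_ p = cyl v a.
Proof.
move=> p1; rewrite /X_; case hs: (posneg (word p)) => [[[|e a] [|f b]]|]; try by left.
- by move/posnegP: hs => hp; case/eqP: p1; apply: val_inj.
- case: ifP => _; [right|by left].
  exists (tgt (last f b)), [::]; apply/seteqP; split=> x /=; first by split.
  by case.
- case: ifP => _; [right|by left].
  exists (src e), (e :: a); apply/seteqP; split=> x; last by case.
  by move=> h; split=> //; apply: starts_src h.
- case: ifP => _; [right|by left].
  exists (src e), (e :: a); apply/seteqP; split=> x; last by case.
  by move=> h; split=> //; apply: starts_src h.
Qed.

Lemma Xv_cyl v : Xv v = cyl v [::].
Proof. by apply/seteqP; split=> x; [split|case]. Qed.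

Lemma starts_cmp a b :
  (forall x : boundary E, starts a (bval x) -> starts b (bval x)) \/
  (forall x : boundary E, starts b (bval x) -> starts a (bval x)) \/
  (forall x : boundary E, starts a (bval x) -> starts b (bval x) -> False).
Proof.
suff : (forall x : bword E, starts a x -> starts b x) \/
  (forall x, starts b x -> starts a x) \/
  (forall x, starts a x -> starts b x -> False).
  by case=> [h|[h|h]]; [left|right; left|right; right] => x; apply: h.
elim: a b => [|e a IH] [|f b]; [by left|by right; left|by left|].
have [<-|ef] := eqVneq e f; last first.
  right; right=> x /= /andP[/eqP -> _] /andP[/eqP[h] _].
  by rewrite h eqxx in ef.
case: (IH b) => [h|[h|h]]; [left|right; left|right; right] => x /= /andP[-> h1].
- exact: h.
- exact: h.
- by apply: h.
Qed.

Lemma cyl_cap v a w b :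
  [\/ cyl v a `&` cyl w b = set0, cyl v a `&` cyl w b = cyl v a |
      cyl v a `&` cyl w b = cyl w b].
Proof.
have [->|vw] := eqVneq v w; last first.
  apply: Or31; rewrite -subset0 => x [[h1 _] [h2 _]].
  by move: vw; rewrite -h1 -h2 eqxx.
case: (starts_cmp a b) => [h|[h|h]].
- apply: Or32; apply/seteqP; split=> x; first by case.
  by move=> [h1 h2]; do 2!split=> //; apply: h.
- apply: Or33; apply/seteqP; split=> x; first by case.
  by move=> [h1 h2]; do 2!split=> //; apply: h.
- apply: Or31; rewrite -subset0 => x [[_ h1] [_ h2]].
  exact: h h1 h2.
Qed.

Lemma gens_cyl f : gens f -> f = 0 \/ exists v a, f = \1_(cyl v a).
Proof.
case=> [[p p1 ->]|[v ->]]; last first.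
  by right; exists v, [::]; rewrite /onev Xv_cyl.
case: (X_cyl p1) => [h|[v [a h]]]; rewrite /one_ h; last by right; exists v, a.
by left; rewrite indic0.
Qed.

Lemma gensM f g : gens f -> gens g -> f * g = 0 \/ gens (f * g).
Proof.
move=> hf hg.
case: (gens_cyl hf) => [->|[v [a ef]]]; first by left; rewrite mul0r.
case: (gens_cyl hg) => [->|[w [b eg]]]; first by left; rewrite mulr0.
have : f * g = \1_(cyl v a `&` cyl w b) by rewrite indicI ef eg.
case: (cyl_cap v a w b) => -> ->.
- by left; rewrite indic0.
- by right; rewrite -ef.
- by right; rewrite -eg.
Qed.

Lemma fscalerAl k f g : (k *: f) * g = k *: (f * g).
Proof. by apply/funext => x; apply: esym; apply: mulrA. Qed.

Lemma fscalerAr k f g : f * (k *: g) = k *: (f * g).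
Proof. by rewrite mulrC fscalerAl mulrC. Qed.

Lemma D0M f g : D0 f -> D0 g -> D0 (f * g).
Proof.
move=> hf hg; move: f hf; apply: lspan_ind => [|k f f' hf hf'] /=.
  by rewrite mul0r; apply: lspan0.
rewrite mulrDl fscalerAl; apply: lspanD => //; apply: lspanZ.
move: g hg {hf'}; apply: lspan_ind => [|l g g' hg hg'] /=.
  by rewrite mulr0; apply: lspan0.
rewrite mulrDr fscalerAr; apply: lspanD => //; apply: lspanZ.
by case: (gensM hf hg) => [->|h]; [apply: lspan0|apply: lspan_gen].
Qed.

Lemma D_D0 p f : D_ p f -> D0 f.
Proof.
case=> g hg <-; have [->|p1] := eqVneq p 1%g; first by rewrite one_1 mul1r.
by apply: D0M => //; apply: lspan_gen; left; exists p.
Qed.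

Lemma D_1 : D_ 1%g = D0.
Proof.
apply/seteqP; split; first by move=> f; apply: D_D0.
by move=> f hf; exists f; rewrite ?one_1 ?mul1r.
Qed.

Lemma D_one p : p != 1%g -> D_ p (one_ p).
Proof. by move=> hp; exists (one_ p); [apply: lspan_gen; left; exists p|apply: one_sqr]. Qed.

Lemma D_onev v : D_ 1%g (onev v).
Proof. by rewrite D_1; apply: lspan_gen; right; exists v. Qed.

Lemma D_supp p f : D_ p f -> one_ p * f = f.
Proof. by case=> g _ <-; rewrite mulrA one_sqr. Qed.

Lemma D_zero p : D_ p 0.
Proof. by exists 0; [apply: lspan0|rewrite mulr0]. Qed.

Lemma D_lin p k f g : D_ p f -> D_ p g -> D_ p (k *: f + g).
Proof.
move=> [f' hf <-] [g' hg <-]; exists (k *: f' + g').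
  by apply: lspanD => //; apply: lspanZ.
by rewrite mulrDr fscalerAr.
Qed.

Lemma D_mulr p f g : D_ p f -> D0 g -> D_ p (f * g).
Proof.
by move=> [f' hf <-] hg; exists (f' * g); [apply: D0M|rewrite mulrA].
Qed.

Lemma onev_gen p v : p != 1%g -> one_ p * onev v = 0 \/ one_ p * onev v = one_ p.
Proof.
move=> p1; have : one_ p * onev v = \1_(X_ p `&` Xv v) by rewrite indicI.
case: (X_cyl p1) => [h|[w [a h]]].
  by rewrite h set0I indic0 => ->; left.
have [vw|vw] := eqVneq w v => ->; [right|left].
  congr (\1_ _); apply/seteqP; split=> x; first by case.
  by move=> hx; split=> //; move: hx; rewrite h => -[]; rewrite vw.
rewrite h (_ : _ `&` _ = set0) ?indic0 //; rewrite -subset0 => x [[h1 _] h2].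
by move: vw; rewrite -h1 h2 eqxx.
Qed.

Lemma alpha_D0 p f : D0 f -> D_ p (alpha p f).
Proof.
move: f; apply: lspan_ind => [|k f g]; first by rewrite /= alpha0; apply: D_zero.
move=> hf hg /=; rewrite alphaD alphaZ; apply: D_lin => //.
have [->|p1] := eqVneq p 1%g.
  rewrite D_1 (_ : alpha _ f = f); first by apply: lspan_gen.
  by apply/funext => x; rewrite /alpha invg1 theta1.
case: hf => [[q q1 ->]|[v ->]].
  rewrite alpha_one; have [->|pq1] := eqVneq (p * q)%g 1%g.
    by rewrite one_1 mulr1; apply: D_one.
  apply: D_mulr; first exact: D_one.
  by apply: lspan_gen; left; exists (p * q)%g.
have -> : alpha p (onev v) = alpha p (one_ p^-1%g * onev v).
  by rewrite alphaM alpha_one mulgV one_1 mulr1 -alpha_supp.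
have pV : p^-1%g != 1%g by rewrite invg_eq1.
case: (onev_gen v pV) => ->; first by rewrite alpha0; apply: D_zero.
by rewrite alpha_one mulgV one_1 mulr1; apply: D_one.
Qed.

Lemma alpha_D p q f g : D_ p f -> D_ q g ->
  D_ (p * q)%g (alpha p (alpha p^-1%g f * g)).
Proof.
move=> hf [h hh <-].
have h1 : D0 (alpha p^-1%g f * h).
  by apply: D0M => //; apply: (@D_D0 p^-1%g); apply: alpha_D0; apply: D_D0 hf.
exists (alpha p (alpha p^-1%g f * h)); first by apply: D_D0; apply: alpha_D0.
rewrite (mulrCA (alpha _ f)) [RHS]alphaM alpha_one -mulrA [RHS]mulrCA.
by rewrite -alpha_supp.
Qed.

Lemma alpha_mulE p f g x : D_ p f ->
  alpha p (alpha p^-1%g f * g) x =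
  f x * (if theta p^-1%g x is Some y then g y else 0).
Proof.
move=> hf; rewrite alphaM alphaK D_supp //.
Qed.

Definition is_skew (a : free_group (edge E) -> FX) : Prop :=
  finite_set [set p | a p != 0] /\ forall p, D_ p (a p).

Definition skew_pred : {pred free_group (edge E) -> FX} :=
  fun a => `[< is_skew a >].

(* The formal sum of the a_p delta_p is recorded as the function p |-> a_p. *)
Record skew_ring := Skew {
  coef : free_group (edge E) -> FX;
  _ : coef \in skew_pred }.

HB.instance Definition _ := [isSub for coef].
HB.instance Definition _ := [Choice of skew_ring by <:].

Lemma skew_closed : submod_closed skew_pred.
Proof.
split=> [|k a b]; first apply/asboolP.
  split; last by move=> p; apply: D_zero.
  by rewrite (_ : [set _ | _] = set0) // -subset0 => p /=; rewrite eqxx.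
move=> /asboolP[fa Da] /asboolP[fb Db]; apply/asboolP; split.
  apply: (@sub_finite_set _ _ ([set p | a p != 0] `|` [set p | b p != 0])).
    move=> p /= h; have [a0|] := eqVneq (a p) 0; last by left.
    right; apply: contra h => /eqP b0.
    by rewrite -[X in X == _]/(k *: a p + b p) a0 b0 scaler0 addr0.
  by rewrite finite_setU.
by move=> p; apply: D_lin.
Qed.

HB.instance Definition _ := GRing.isSubmodClosed.Build K _ skew_pred skew_closed.
HB.instance Definition _ := [SubChoice_isSubLmodule of skew_ring by <:].

Lemma skewP (a : skew_ring) : is_skew (coef a).
Proof. by apply/asboolP; apply: (valP a). Qed.

(* The coefficient of delta_r collects the products (a_p delta_p)(b_q delta_q)
   with p q = r; the family summed over has finite support. *)
Definition smul_coef (a b : free_group (edge E) -> FX) : free_group (edge E) -> FX :=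
  fun r => \sum_(p \in [set: free_group (edge E)])
    alpha p (alpha p^-1%g (a p) * b (p^-1 * r)%g).

Definition supp (a : free_group (edge E) -> FX) : {fset free_group (edge E)} :=
  fset_set [set p | a p != 0].

Lemma suppP a p : is_skew a -> p \notin supp a -> a p = 0.
Proof.
move=> [fa _]; rewrite /supp in_fset_set // => h.
by apply/eqP; move: h; apply: contraNT => h; rewrite inE.
Qed.

Lemma smulE (A : {fset free_group (edge E)}) a b r x : is_skew a ->
  (forall p, p \notin A -> a p = 0) ->
  smul_coef a b r x =
    \sum_(p <- A) a p x * oapp (b (p^-1 * r)%g) 0 (theta p^-1%g x).
Proof.
move=> ha hA; rewrite /smul_coef (@fsbigTE _ _ _ _ A); last first.
  by move=> p /hA ->; rewrite alpha0 mul0r alpha0.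
rewrite fct_sumE; apply: eq_bigr => p _; rewrite alpha_mulE; last by case: ha.
by case: theta.
Qed.

Lemma smul_skew a b : is_skew a -> is_skew b -> is_skew (smul_coef a b).
Proof.
move=> ha hb; split; last first.
  move=> r; rewrite /smul_coef (@fsbigTE _ _ _ _ (supp a)); last first.
    by move=> p /(suppP ha) ->; rewrite alpha0 mul0r alpha0.
  elim/big_ind: _ => [|f g hf hg|p _]; first exact: D_zero.
    by rewrite -[f]scale1r; apply: D_lin.
  rewrite -{1}(mulVKg p r); apply: alpha_D; [apply: ha.2|exact: hb.2].
apply: (@sub_finite_set _ _ [set (p * q)%g | p in [set p | a p != 0] & q in [set p | b p != 0]]).
  move=> r /= /eqP h; apply: contrapT => hn; apply: h.
  rewrite /smul_coef fsbig1 // => p _.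
  have [->|ap] := eqVneq (a p) 0; first by rewrite alpha0 mul0r alpha0.
  have [->|bp] := eqVneq (b (p^-1 * r)%g) 0; first by rewrite mulr0 alpha0.
  by case: hn; exists p => //; exists (p^-1 * r)%g => //; rewrite mulVKg.
by apply: finite_image2; [case: ha|case: hb].
Qed.

Definition smul (a b : skew_ring) : skew_ring :=
  Skew (asboolT (smul_skew (skewP a) (skewP b))).

Lemma smul_at (A : {fset free_group (edge E)}) (a b : skew_ring) r x :
  (forall p, p \notin A -> coef a p = 0) ->
  coef (smul a b) r x =
    \sum_(p <- A) coef a p x * oapp (coef b (p^-1 * r)%g) 0 (theta p^-1%g x).
Proof. by move=> hA; apply: smulE => //; apply: skewP. Qed.

Lemma coefD (a b : skew_ring) p x : coef (a + b) p x = coef a p x + coef b p x.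
Proof. by []. Qed.

Lemma coefZ k (a : skew_ring) p x : coef (k *: a) p x = k *: coef a p x.
Proof. by []. Qed.

Lemma skew_ext (a b : skew_ring) : (forall p x, coef a p x = coef b p x) -> a = b.
Proof. by move=> h; apply: val_inj; apply/funext => p; apply/funext => x; apply: h. Qed.

Lemma smulDr : right_distributive smul +%R.
Proof.
move=> a b c; apply: skew_ext => r x; rewrite coefD.
have h p : p \notin supp (coef a) -> coef a p = 0 by apply: suppP; apply: skewP.
rewrite !(smul_at _ _ _ h) -big_split; apply: eq_bigr => p _ /=.
by rewrite -mulrDr; congr (_ * _); case: theta => //=; rewrite addr0.
Qed.

Lemma smulDl : left_distributive smul +%R.
Proof.
move=> a b c; apply: skew_ext => r x; rewrite coefD.
have h (d : skew_ring) p : p \notin supp (coef d) -> coef d p = 0.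
  by apply: suppP; apply: skewP.
pose A := (supp (coef a) `|` supp (coef b))%fset.
have hA p : p \notin A -> coef a p = 0 /\ coef b p = 0.
  by rewrite in_fsetU negb_or => /andP[/h ? /h ?].
rewrite !(@smul_at A); try by move=> p /hA[h1 h2].
  rewrite -big_split; apply: eq_bigr => p _ /=.
  by rewrite -mulrDl.
by move=> p /hA[h1 h2]; rewrite -[LHS]/(coef a p + coef b p) h1 h2 addr0.
Qed.

Lemma smulZl k a b : smul (k *: a) b = k *: smul a b.
Proof.
apply: skew_ext => r x; rewrite coefZ.
have h p : p \notin supp (coef a) -> coef a p = 0 by apply: suppP; apply: skewP.
rewrite !(@smul_at (supp (coef a))) //; last first.
  by move=> p /h h1; rewrite -[LHS]/(k *: coef a p) h1 scaler0.
rewrite scaler_sumr; apply: eq_bigr => p _.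
by rewrite coefZ; rewrite -scalerAl.
Qed.

Lemma smulZr k a b : smul a (k *: b) = k *: smul a b.
Proof.
apply: skew_ext => r x; rewrite coefZ.
have h p : p \notin supp (coef a) -> coef a p = 0 by apply: suppP; apply: skewP.
rewrite !(smul_at _ _ _ h) scaler_sumr; apply: eq_bigr => p _.
by case: theta => [y|] /=; rewrite ?mulr0 ?scaler0 // scalerAr.
Qed.

Lemma smulA : associative smul.
Proof.
move=> a b c; apply: skew_ext => r x.
have h (d : skew_ring) p : p \notin supp (coef d) -> coef d p = 0.
  by apply: suppP; apply: skewP.
pose A := supp (coef a); pose B := supp (coef b).
pose U := [fset (p * q)%g | p in A, q in B]%fset.
have hU p : p \notin U -> coef (smul a b) p = 0.
  move=> hp; apply/funext => y; rewrite (@smul_at A _ _ _ _ (h a)).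
  rewrite big_seq big1 // => q qA.
  suff -> : coef b (q^-1 * p)%g = 0 by case: theta => [z|]; apply: mulr0.
  apply: h.
  apply: contra hp => hp; apply/imfset2P; exists q => //.
  by exists (q^-1 * p)%g => //; rewrite mulVKg.
rewrite (@smul_at A _ _ _ _ (h a)) (@smul_at U _ _ _ _ hU).
transitivity (\sum_(u <- U) \sum_(p <- A) (coef a p x *
  oapp (coef b (p^-1 * u)%g) 0 (theta p^-1%g x)) *
  oapp (coef c (u^-1 * r)%g) 0 (theta u^-1%g x)); last first.
  by apply: eq_bigr => u _; rewrite (@smul_at A _ _ _ _ (h a)) mulr_suml.
rewrite exchange_big /= big_seq [RHS]big_seq; apply: eq_bigr => p pA.
case hp: (theta p^-1%g x) => [y|] /=; last first.
  by rewrite mulr0 big1 // => u _; rewrite mul0r.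
rewrite (@smulE B _ _ _ _ (skewP b) (h b)) mulr_sumr.
pose F q := coef a p x * coef b q y *
  oapp (coef c (q^-1 * (p^-1 * r))%g) 0 (theta (p * q)^-1%g x).
have FE u : coef a p x * coef b (p^-1 * u)%g y *
    oapp (coef c (u^-1 * r)%g) 0 (theta u^-1%g x) = F (p^-1 * u)%g.
  by rewrite /F invgM invgK mulVKg -mulgA (mulgA p) mulgV mul1g.
under [RHS]eq_bigr => u _ do rewrite FE.
transitivity (\sum_(q <- B) F q).
  apply: eq_bigr => q _; rewrite /F -mulrA; congr (_ * _).
  rewrite invgM; case hq: (theta q^-1%g y) => [z|] /=.
    by rewrite (thetaM hp hq).
  have [_ Db] := skewP b; suff -> : coef b q y = 0 by rewrite !mul0r.
  rewrite -(D_supp (Db q)) -[LHS]/(one_ q y * coef b q y) one_E hq /=.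
  by rewrite mul0r.
rewrite -(@fsbigTE _ _ _ _ B); last by move=> q /h hq; rewrite /F hq mulr0 mul0r.
rewrite -(@fsbigTE _ _ _ _ U (fun u => F (p^-1 * u)%g)); last first.
  move=> u hu; rewrite /F (h b (p^-1 * u)%g) ?mulr0 ?mul0r //.
  apply: contra hu => hu; apply/imfset2P; exists p => //.
  by exists (p^-1 * u)%g => //; rewrite mulVKg.
apply: reindex_fsbigT; exists (fun q => (p * q)%g); [exact: mulVKg|exact: mulKg].
Qed.

HB.instance Definition _ :=
  isNUAlgebra.Build K skew_ring smulA smulDl smulDr smulZl smulZr.

Definition delta_coef p f : free_group (edge E) -> FX :=
  fun q => if q == p then f else 0.

Lemma delta_skew p f : D_ p f -> is_skew (delta_coef p f).
Proof.
move=> hf; split=> [|q]; last first.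
  by rewrite /delta_coef; case: eqP => [->|_] //; apply: D_zero.
apply: (@sub_finite_set _ _ [set p]); last exact: finite_set1.
by move=> q /=; rewrite /delta_coef; case: (q =P p) => // _; rewrite eqxx.
Qed.

Definition delta p f (hf : D_ p f) : skew_ring := Skew (asboolT (delta_skew hf)).

Arguments delta : clear implicits.

Lemma delta_mul p q f g (hf : D_ p f) (hg : D_ q g) :
  nmul (delta p f hf) (delta q g hg) =
  delta (p * q)%g (alpha p (alpha p^-1%g f * g)) (alpha_D hf hg).
Proof.
apply: val_inj; apply/funext => r.
rewrite /= /smul_coef (@fsbigTE _ _ _ _ [fset p]%fset); last first.
  move=> s; rewrite in_fset1 /delta_coef => /negbTE ->.
  by rewrite alpha0 mul0r alpha0.
rewrite big_seq_fset1 /delta_coef eqxx.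
have -> : ((p^-1 * r)%g == q) = (r == (p * q)%g).
  apply/eqP/eqP => [<-|->]; first by rewrite mulVKg.
  by rewrite mulKg.
by case: eqP => // _; rewrite mulr0 alpha0.
Qed.

Lemma edge_neq1 (e : edge E) : gen e != 1%g.
Proof. by []. Qed.

Lemma ghost_neq1 (e : edge E) : (gen e)^-1%g != 1%g.
Proof. by []. Qed.

Definition skew_vertex v : skew_ring := delta 1%g (onev v) (D_onev v).
Definition skew_edge (e : edge E) : skew_ring :=
  delta (gen e) (one_ (gen e)) (D_one (edge_neq1 e)).
Definition skew_ghost (e : edge E) : skew_ring :=
  delta (gen e)^-1%g (one_ (gen e)^-1%g) (D_one (ghost_neq1 e)).

End SkewRing.

Section Leavitt.
Variables (K : fieldType) (E : digraph).
Implicit Types (v w : vertex E) (e f : edge E).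

(* Nonunital algebra terms in the vertices, the edges e and the ghosts e^*. *)
Inductive lterm :=
| TVertex of vertex E
| TEdge of edge E
| TGhost of edge E
| TZero
| TAdd of lterm & lterm
| TScale of K & lterm
| TMul of lterm & lterm.

Definition tsum (s : seq lterm) : lterm := foldr TAdd TZero s.

(* The congruence generated by the axioms of associative K-algebras and the
   defining relations of L_K(E). *)
Inductive lrel : lterm -> lterm -> Prop :=
| lrel_refl x : lrel x x
| lrel_sym x y : lrel x y -> lrel y x
| lrel_trans x y z : lrel x y -> lrel y z -> lrel x z
| lrel_add x x' y y' : lrel x x' -> lrel y y' -> lrel (TAdd x y) (TAdd x' y')
| lrel_scale k x x' : lrel x x' -> lrel (TScale k x) (TScale k x')
| lrel_mul x x' y y' : lrel x x' -> lrel y y' -> lrel (TMul x y) (TMul x' y')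
| lrel_addA x y z : lrel (TAdd x (TAdd y z)) (TAdd (TAdd x y) z)
| lrel_addC x y : lrel (TAdd x y) (TAdd y x)
| lrel_add0 x : lrel (TAdd TZero x) x
| lrel_scaleA k l x : lrel (TScale k (TScale l x)) (TScale (k * l) x)
| lrel_scale1 x : lrel (TScale 1 x) x
| lrel_scale0 x : lrel (TScale 0 x) TZero
| lrel_scaleDr k x y : lrel (TScale k (TAdd x y)) (TAdd (TScale k x) (TScale k y))
| lrel_scaleDl k l x : lrel (TScale (k + l) x) (TAdd (TScale k x) (TScale l x))
| lrel_mulA x y z : lrel (TMul x (TMul y z)) (TMul (TMul x y) z)
| lrel_mulDl x y z : lrel (TMul (TAdd x y) z) (TAdd (TMul x z) (TMul y z))
| lrel_mulDr x y z : lrel (TMul x (TAdd y z)) (TAdd (TMul x y) (TMul x z))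
| lrel_mulZl k x y : lrel (TMul (TScale k x) y) (TScale k (TMul x y))
| lrel_mulZr k x y : lrel (TMul x (TScale k y)) (TScale k (TMul x y))
| lrel_vv v : lrel (TMul (TVertex v) (TVertex v)) (TVertex v)
| lrel_vw v w : v <> w -> lrel (TMul (TVertex v) (TVertex w)) TZero
| lrel_se e : lrel (TMul (TVertex (src e)) (TEdge e)) (TEdge e)
| lrel_er e : lrel (TMul (TEdge e) (TVertex (tgt e))) (TEdge e)
| lrel_rg e : lrel (TMul (TVertex (tgt e)) (TGhost e)) (TGhost e)
| lrel_gs e : lrel (TMul (TGhost e) (TVertex (src e))) (TGhost e)
| lrel_gf e f : e <> f -> lrel (TMul (TGhost e) (TEdge f)) TZero
| lrel_ge e : lrel (TMul (TGhost e) (TEdge e)) (TVertex (tgt e))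
| lrel_ck2 v (l : seq (edge E)) :
    uniq l -> l <> [::] -> (forall e, (e \in l) = (src e == v)) ->
    lrel (TVertex v) (tsum [seq TMul (TEdge e) (TGhost e) | e <- l]).

HB.instance Definition _ := gen_eqMixin lterm.
HB.instance Definition _ := gen_choiceMixin lterm.

Definition lrelb (x y : lterm) : bool := `[< lrel x y >].

Lemma lrelb_equiv : equiv_class_of lrelb.
Proof.
split=> [x|x y|y x z].
- exact/asboolP/lrel_refl.
- by apply/idP/idP => /asboolP h; apply/asboolP/lrel_sym.
- by move=> /asboolP h1 /asboolP h2; apply/asboolP; apply: lrel_trans h2.
Qed.

Canonical lrelb_equiv_rel := EquivRelPack lrelb_equiv.

Definition leavitt := {eq_quot lrelb_equiv_rel}.

HB.instance Definition _ := Choice.on leavitt.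

Definition lpi (x : lterm) : leavitt := \pi_leavitt x.

Lemma lpiP x y : lrel x y <-> lpi x = lpi y.
Proof. by split=> [h|/eqmodP/asboolP//]; apply/eqmodP/asboolP. Qed.

Lemma lpi_repr (x : leavitt) : lpi (repr x) = x.
Proof. exact: reprK. Qed.

Lemma lrel_repr x : lrel (repr (lpi x)) x.
Proof. by apply/lpiP; rewrite lpi_repr. Qed.

Definition ladd (x y : leavitt) : leavitt := lpi (TAdd (repr x) (repr y)).
Definition lscale k (x : leavitt) : leavitt := lpi (TScale k (repr x)).
Definition lmul (x y : leavitt) : leavitt := lpi (TMul (repr x) (repr y)).
Definition lopp (x : leavitt) : leavitt := lscale (-1) x.

Lemma lpiD x y : ladd (lpi x) (lpi y) = lpi (TAdd x y).
Proof. by apply/lpiP; apply: lrel_add; apply: lrel_repr. Qed.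

Lemma lpiZ k x : lscale k (lpi x) = lpi (TScale k x).
Proof. by apply/lpiP; apply: lrel_scale; apply: lrel_repr. Qed.

Lemma lpiM x y : lmul (lpi x) (lpi y) = lpi (TMul x y).
Proof. by apply/lpiP; apply: lrel_mul; apply: lrel_repr. Qed.

Lemma lpi_ind (P : leavitt -> Prop) : (forall x, P (lpi x)) -> forall x, P x.
Proof. by move=> h x; rewrite -(lpi_repr x). Qed.

Lemma laddA : associative ladd.
Proof.
elim/lpi_ind=> x; elim/lpi_ind=> y; elim/lpi_ind=> z.
by rewrite !lpiD; apply/lpiP/lrel_addA.
Qed.

Lemma laddC : commutative ladd.
Proof.
by elim/lpi_ind=> x; elim/lpi_ind=> y; rewrite !lpiD; apply/lpiP/lrel_addC.
Qed.

Lemma ladd0 : left_id (lpi TZero) ladd.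
Proof. by elim/lpi_ind=> x; rewrite lpiD; apply/lpiP/lrel_add0. Qed.

Lemma laddN : left_inverse (lpi TZero) lopp ladd.
Proof.
elim/lpi_ind=> x; rewrite /lopp lpiZ lpiD; apply/lpiP.
apply: lrel_trans (lrel_scale0 x); rewrite -(addNr 1).
apply: lrel_sym; apply: lrel_trans (lrel_scaleDl _ _ _) _.
by apply: lrel_add; [apply: lrel_refl|apply: lrel_scale1].
Qed.

HB.instance Definition _ := GRing.isZmodule.Build leavitt laddA laddC ladd0 laddN.

Lemma lscaleA k l x : lscale k (lscale l x) = lscale (k * l) x.
Proof. by elim/lpi_ind: x => x; rewrite !lpiZ; apply/lpiP/lrel_scaleA. Qed.

Lemma lscale1 : left_id 1 lscale.
Proof. by elim/lpi_ind=> x; rewrite lpiZ; apply/lpiP/lrel_scale1. Qed.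

Lemma lscaleDr : right_distributive lscale +%R.
Proof.
move=> k; elim/lpi_ind=> x; elim/lpi_ind=> y.
rewrite -![_ + _]/(ladd _ _) lpiD !lpiZ lpiD; exact/lpiP/lrel_scaleDr.
Qed.

Lemma lscaleDl x : {morph lscale^~ x : k l / k + l}.
Proof.
elim/lpi_ind: x => x k l /=.
rewrite !lpiZ -[RHS]/(ladd _ _) lpiD; exact/lpiP/lrel_scaleDl.
Qed.

HB.instance Definition _ := GRing.Zmodule_isLmodule.Build K leavitt
  lscaleA lscale1 lscaleDr lscaleDl.

Lemma lmulA : associative lmul.
Proof.
elim/lpi_ind=> x; elim/lpi_ind=> y; elim/lpi_ind=> z.
by rewrite !lpiM; apply/lpiP/lrel_mulA.
Qed.

Lemma lmulDl : left_distributive lmul +%R.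
Proof.
elim/lpi_ind=> x; elim/lpi_ind=> y; elim/lpi_ind=> z.
rewrite -![_ + _]/(ladd _ _) lpiD !lpiM lpiD; exact/lpiP/lrel_mulDl.
Qed.

Lemma lmulDr : right_distributive lmul +%R.
Proof.
elim/lpi_ind=> x; elim/lpi_ind=> y; elim/lpi_ind=> z.
rewrite -![_ + _]/(ladd _ _) lpiD !lpiM lpiD; exact/lpiP/lrel_mulDr.
Qed.

Lemma lmulZl k x y : lmul (k *: x) y = k *: lmul x y.
Proof.
elim/lpi_ind: x => x; elim/lpi_ind: y => y.
rewrite -![_ *: _]/(lscale _ _) lpiZ !lpiM lpiZ; exact/lpiP/lrel_mulZl.
Qed.

Lemma lmulZr k x y : lmul x (k *: y) = k *: lmul x y.
Proof.
elim/lpi_ind: x => x; elim/lpi_ind: y => y.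
rewrite -![_ *: _]/(lscale _ _) lpiZ !lpiM lpiZ; exact/lpiP/lrel_mulZr.
Qed.

HB.instance Definition _ :=
  isNUAlgebra.Build K leavitt lmulA lmulDl lmulDr lmulZl lmulZr.

Definition lvertex v : leavitt := lpi (TVertex v).
Definition ledge e : leavitt := lpi (TEdge e).
Definition lghost e : leavitt := lpi (TGhost e).

(* The defining relations of L_K(E), read in an arbitrary algebra. *)
Record leavitt_family (A : nuAlgType K) (P : vertex E -> A) (S T : edge E -> A) :
  Prop := LeavittFamily {
  lf_vv : forall v, nmul (P v) (P v) = P v;
  lf_vw : forall v w, v <> w -> nmul (P v) (P w) = 0;
  lf_se : forall e, nmul (P (src e)) (S e) = S e;
  lf_er : forall e, nmul (S e) (P (tgt e)) = S e;
  lf_rg : forall e, nmul (P (tgt e)) (T e) = T e;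
  lf_gs : forall e, nmul (T e) (P (src e)) = T e;
  lf_gf : forall e f, e <> f -> nmul (T e) (S f) = 0;
  lf_ge : forall e, nmul (T e) (S e) = P (tgt e);
  lf_ck2 : forall v (l : seq (edge E)),
    uniq l -> l <> [::] -> (forall e, (e \in l) = (src e == v)) ->
    P v = \sum_(e <- l) nmul (S e) (T e) }.

Lemma lpi_sum (s : seq lterm) : lpi (tsum s) = \sum_(x <- s) lpi x.
Proof.
elim: s => [|x s IH]; first by rewrite big_nil.
by rewrite big_cons -IH -[RHS]/(ladd _ _) lpiD.
Qed.

Lemma leavitt_is_family : leavitt_family lvertex ledge lghost.
Proof.
have M x y : nmul (lpi x) (lpi y) = lpi (TMul x y) by apply: lpiM.
split=> [v|v w h|e|e|e|e|e f h|e|v l h1 h2 h3]; rewrite ?M; try apply/lpiP.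
- exact: lrel_vv.
- exact: lrel_vw.
- exact: lrel_se.
- exact: lrel_er.
- exact: lrel_rg.
- exact: lrel_gs.
- exact: lrel_gf.
- exact: lrel_ge.
- rewrite /lvertex; have /lpiP -> := lrel_ck2 h1 h2 h3.
  by rewrite lpi_sum big_map; apply: eq_bigr => e _; rewrite M.
Qed.

Section Universal.
Variables (A : nuAlgType K) (P : vertex E -> A) (S T : edge E -> A).

Fixpoint teval (x : lterm) : A :=
  match x with
  | TVertex v => P v
  | TEdge e => S e
  | TGhost e => T e
  | TZero => 0
  | TAdd x y => teval x + teval y
  | TScale k x => k *: teval x
  | TMul x y => nmul (teval x) (teval y)
  end.

Lemma teval_sum (s : seq lterm) : teval (tsum s) = \sum_(x <- s) teval x.
Proof. by elim: s => [|x s IH]; rewrite ?big_nil // big_cons -IH. Qed.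

Lemma teval_lrel x y : leavitt_family P S T -> lrel x y -> teval x = teval y.
Proof.
move=> F; elim=> {x y} //=.
- by move=> x y z _ -> _ ->.
- by move=> x x' y y' _ -> _ ->.
- by move=> k x x' _ ->.
- by move=> x x' y y' _ -> _ ->.
- by move=> *; rewrite addrA.
- by move=> *; rewrite addrC.
- by move=> *; rewrite add0r.
- by move=> *; rewrite scalerA.
- by move=> *; rewrite scale1r.
- by move=> *; rewrite scale0r.
- by move=> *; rewrite scalerDr.
- by move=> *; rewrite scalerDl.
- by move=> *; rewrite nmulA.
- by move=> *; rewrite nmulDl.
- by move=> *; rewrite nmulDr.
- by move=> *; rewrite nmulZl.
- by move=> *; rewrite nmulZr.
- exact: (lf_vv F).
- exact: (lf_vw F).
- exact: (lf_se F).
- exact: (lf_er F).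
- exact: (lf_rg F).
- exact: (lf_gs F).
- exact: (lf_gf F).
- exact: (lf_ge F).
- by move=> v l h1 h2 h3; rewrite teval_sum big_map; apply: (lf_ck2 F).
Qed.

Lemma leavitt_universal : leavitt_family P S T ->
  exists! phi : leavitt -> A,
    [/\ nualg_hom phi, forall v, phi (lvertex v) = P v,
        forall e, phi (ledge e) = S e & forall e, phi (lghost e) = T e].
Proof.
move=> F; pose phi (x : leavitt) := teval (repr x).
have phiE x : phi (lpi x) = teval x by apply: (teval_lrel F); apply: lrel_repr.
exists phi; split; first split=> [|v|e|e]; rewrite ?phiE //; first split.
- move=> k; elim/lpi_ind=> x; elim/lpi_ind=> y.
  rewrite -[k *: lpi x]/(lscale k (lpi x)) -[_ + lpi y]/(ladd _ _).
  by rewrite lpiZ lpiD !phiE.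
- elim/lpi_ind=> x; elim/lpi_ind=> y.
  by rewrite -[nmul (lpi x) _]/(lmul _ _) lpiM !phiE.
move=> psi [[hl hm] hv he hg]; apply/funext; elim/lpi_ind=> x; rewrite phiE.
have h0 : psi 0 = 0.
  by have := hl (-1) 0 0; rewrite scaleN1r addNr scaleN1r addNr.
elim: x => [v|e|e||x IHx y IHy|k x IHx|x IHx y IHy] /=.
- by rewrite -(hv v).
- by rewrite -(he e).
- by rewrite -(hg e).
- exact: esym h0.
- by rewrite IHx IHy -lpiD -[ladd _ _]/(lpi x + lpi y) -[lpi x]scale1r hl !scale1r.
- rewrite IHx -lpiZ -[lscale _ _]/(k *: lpi x) -[k *: lpi x]addr0 hl h0.
  by rewrite addr0.
- by rewrite IHx IHy -lpiM -hm.
Qed.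

End Universal.

End Leavitt.

(* Main.v *)
Require Import Defs.
From mathcomp Require Import all_boot all_algebra.
From mathcomp Require Import finmap boolp classical_sets functions numfun.

Set Implicit Arguments.
Unset Strict Implicit.
Unset Printing Implicit Defensive.

Import GRing.Theory.
Local Open Scope classical_set_scope.
Local Open Scope ring_scope.

(** Existence and uniqueness of the homomorphism come from the universal
property once the images of the generators are seen to satisfy the defining
relations ([skew_family]); what has to be proved is bijectivity.

Surjectivity.  Since [a delta_p = (a delta_0)(1_p delta_p)] for [a] in [D_p],
it is enough to reach [D_0 delta_0] and every [1_p delta_p].  The algebra [D_0]
is spanned by indicators of cylinders, and prepending an edge [e] to a cylinder
is conjugation by [1_e delta_e] ([attained_cyl]).  The element [1_p delta_p] is
the product of the generators along the reduced word of [p], because [X_p] is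
contained in [X_l] when [l] is the first letter of [p] ([attained_one]).

Injectivity is a uniqueness theorem for the grading by the free group: a
homomorphism [psi] is injective on each span of monomials of one degree in a
Leavitt family as soon as it kills no vertex ([homogeneous_injective]).  Here a
monomial is [a v b^*] with paths [a], [b] and a vertex [v], and its degree is
[a b^-1]; the monomials span the Leavitt path algebra ([leavitt_span]).
Cancelling the longest common suffix [c] of [a] and [b] shows that all monomials
of one degree are [p c v c^* q^*] with the same [p] and [q] ([degree_factor]).
So an element of a component is [p y q^*] with [y] in the span of the diagonal
monomials [c v c^*], and multiplying by [p^*] and [q] reduces the claim to [y].

For diagonal [y] with [psi y = 0], induct on the length of the paths involved
([diagonal_injective]).  By induction [e^* y e = 0] for every edge [e], and this
leaves [v y = k (v - sum of e e^* over l)], for a scalar [k] and a finite set [l]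
of edges leaving [v].  If [l] misses an edge [f] leaving [v], compressing by [f]
gives [k r(f)], and if [v] is a sink the sum is empty; in both cases [k = 0]
since [psi] kills no vertex.  Otherwise [l] consists of all edges leaving [v]
and the right-hand side is zero by the last Leavitt relation.

In the skew group ring the coefficient at [g] isolates the degree [g] part of an
element, so the components may be treated separately, and [1_v] is nonzero
because some boundary path starts at [v] ([boundary_from]). *)

(** * Nonunital algebras and spans *)

Section NonunitalAlgebra.
Variables (K : fieldType) (A B : nuAlgType K).

Lemma nmul0l (x : A) : nmul 0 x = 0.
Proof. by rewrite -(scale0r 0) nmulZl !scale0r. Qed.

Lemma nmul0r (x : A) : nmul x 0 = 0.
Proof. by rewrite -(scale0r 0) nmulZr !scale0r. Qed.

Lemma nmul_suml I (r : seq I) (F : I -> A) x :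
  nmul (\sum_(i <- r) F i) x = \sum_(i <- r) nmul (F i) x.
Proof. by apply: (big_morph (nmul^~ x)); [move=> a b; apply: nmulDl|apply: nmul0l]. Qed.

Lemma nmul_sumr I (r : seq I) (F : I -> A) x :
  nmul x (\sum_(i <- r) F i) = \sum_(i <- r) nmul x (F i).
Proof. by apply: (big_morph (nmul x)); [move=> a b; apply: nmulDr|apply: nmul0r]. Qed.

Variable psi : A -> B.
Hypothesis psiH : nualg_hom psi.

Lemma homM x y : psi (nmul x y) = nmul (psi x) (psi y).
Proof. exact: psiH.2. Qed.

Lemma homD x y : psi (x + y) = psi x + psi y.
Proof. by rewrite -[x]scale1r psiH.1 !scale1r. Qed.

Lemma hom0 : psi 0 = 0.
Proof. by apply: (@addrI _ (psi 0)); rewrite -homD !addr0. Qed.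

Lemma homZ k x : psi (k *: x) = k *: psi x.
Proof. by rewrite -[k *: x]addr0 psiH.1 hom0 addr0. Qed.

Lemma hom_sum I (r : seq I) (Q : pred I) (F : I -> A) :
  psi (\sum_(i <- r | Q i) F i) = \sum_(i <- r | Q i) psi (F i).
Proof. exact: (big_morph psi homD hom0). Qed.

End NonunitalAlgebra.

Lemma lspan_map (K : pzRingType) (V W : lmodType K) (f : V -> W)
    (S : set V) (S' : set W) :
  (forall k x y, f (k *: x + y) = k *: f x + f y) ->
  (forall x, S x -> lspan S' (f x)) -> forall x, lspan S x -> lspan S' (f x).
Proof.
move=> fl fS; apply: lspan_ind => [|k x y Sx hy] /=.
  suff -> : f 0 = 0 by apply: lspan0.
  by rewrite -[0 in LHS](addNr 0) -scaleN1r fl scaleN1r addNr.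
by rewrite fl; apply: lspanD => //; apply: lspanZ; apply: fS.
Qed.

Lemma eq0_by_fibre n (G : eqType) (V : nmodType) (d : 'I_n -> G) (f : 'I_n -> V) :
  (forall g, \sum_(i | d i == g) f i = 0) -> \sum_i f i = 0.
Proof.
move=> h0; transitivity (\sum_i \sum_(g <- undup (codom d) | d i == g) f i).
  apply: eq_bigr => i _; rewrite -big_filter.
  under eq_filter do rewrite eq_sym.
  by rewrite filter_pred1_uniq ?undup_uniq ?mem_undup ?codom_f // big_seq1.
rewrite (exchange_big_dep xpredT) //= big1 // => g _; exact: h0.
Qed.

(** * The free group degree of a pair of paths *)

Section Degree.
Variable E : digraph.
Implicit Types (a b c : seq (edge E)).

Definition path_word a : free_group (edge E) :=
  foldr (fun e p => gen e * p)%g 1%g a.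

Definition degree a b : free_group (edge E) := (path_word a * (path_word b)^-1)%g.

Lemma path_word_cat a b : path_word (a ++ b) = (path_word a * path_word b)%g.
Proof. by elim: a => [|e a IH] /=; rewrite ?mul1g // IH mulgA. Qed.

Lemma word_path a : word (path_word a) = posw a.
Proof.
elim: a => //= e a IH; rewrite IH.
by case: a {IH} => //= f a; rewrite /linv /= xpair_eqE andbF.
Qed.

Lemma degree_catr a b c : degree (a ++ c) (b ++ c) = degree a b.
Proof. by rewrite /degree !path_word_cat invgM mulgA mulgK. Qed.

Lemma winv_posw b : winv (posw b) = negw b.
Proof. by rewrite -[posw b]cats0 -[[::]]/(negw [::]) winv_posneg. Qed.

Lemma wcat_id (u v : seq (edge E * bool)) : reduced (u ++ v) -> wcat u v = u ++ v.
Proof.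
elim: u => //= l u IH h; rewrite IH ?wcons_noncancel //.
exact: reduced_tl h.
Qed.

Lemma reduced_posw a : reduced (posw a).
Proof. by rewrite -word_path; apply: (valP (path_word a)). Qed.

Lemma reduced_negw a : reduced (negw a).
Proof. by rewrite -winv_posw; apply/winv_reduced/reduced_posw. Qed.

(** Letters could cancel only at the junction of the two paths, where their last
edges differ. *)
Lemma reduced_pos_neg a e b f :
  e != f -> reduced (posw (rcons a e) ++ negw (rcons b f)).
Proof.
move=> ef; have ha := reduced_posw (rcons a e); have hb := reduced_negw (rcons b f).
move: ha hb; rewrite /negw rev_rcons /posw map_rcons /=.
case: a => [|g a]; rewrite /reduced /= => ha hb.
  by rewrite hb andbT /noncancel /linv xpair_eqE eq_sym (negbTE ef).
rewrite cat_path ha last_rcons /= hb andbT /noncancel /linv xpair_eqE.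
by rewrite eq_sym (negbTE ef).
Qed.

Lemma strip_common_suffix a b : exists p q c,
  [/\ a = p ++ c, b = q ++ c & reduced (posw p ++ negw q)].
Proof.
elim/last_ind: a b => [|a e IH] b.
  by exists [::], b, [::]; rewrite !cats0; split=> //; exact: reduced_negw.
elim/last_ind: b => [|b f _].
  by exists (rcons a e), [::], [::]; rewrite !cats0; split=> //; apply: reduced_posw.
have [<-|ef] := eqVneq e f.
  have [p [q [c [-> -> h]]]] := IH b.
  by exists p, q, (rcons c e); rewrite !rcons_cat.
exists (rcons a e), (rcons b f), [::]; rewrite !cats0; split=> //.
exact: reduced_pos_neg.
Qed.

(** Reduced words represent group elements uniquely, so [p] and [q] depend on
the degree only: pairs of paths of equal degree differ only in their common
suffix [c]. *)
Lemma degree_factor a b : exists p q c,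
  [/\ posneg (word (degree a b)) = Some (p, q), a = p ++ c & b = q ++ c].
Proof.
have [p [q [c [-> -> h]]]] := strip_common_suffix a b.
exists p, q, c; split=> //; rewrite degree_catr; apply/posnegP.
by rewrite /= !word_path winv_posw wcat_id.
Qed.

End Degree.

(** * Monomials in a Leavitt family *)

Section Family.
Variables (K : fieldType) (E : digraph) (B : nuAlgType K).
Variables (P : vertex E -> B) (S T : edge E -> B).
Hypothesis F : leavitt_family P S T.
Local Notation "x ** y" := (nmul x y) (at level 40, left associativity).

Lemma family_PP v w : P v ** P w = if v == w then P w else 0.
Proof. by have [->|/eqP h] := eqVneq v w; rewrite ?(lf_vv F) // (lf_vw F). Qed.

Lemma family_PS v e : P v ** S e = if v == src e then S e else 0.
Proof. by rewrite -(lf_se F) nmulA family_PP; case: ifP; rewrite ?nmul0l. Qed.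

Lemma family_TP e v : T e ** P v = if src e == v then T e else 0.
Proof.
rewrite -(lf_gs F) -nmulA family_PP.
by case: eqP => [->|]; rewrite ?nmul0r.
Qed.

Lemma family_TS e f : T e ** S f = if e == f then P (tgt f) else 0.
Proof. by have [->|/eqP h] := eqVneq e f; rewrite ?(lf_ge F) // (lf_gf F). Qed.

(** [lpath a x], [rpath x b] and [sandwich a b x] are [a x], [x b^*] and
[a x b^*].  The paths are applied edge by edge to an element because the empty
path is not an element of a nonunital algebra.  All words are allowed: if [a] is
not a path ending at [v], the relations give [lpath a (P v) = 0]. *)
Definition lpath a (x : B) : B := foldr (fun e y => S e ** y) x a.
Definition rpath (x : B) b : B := foldr (fun e y => y ** T e) x b.
Definition sandwich a b x := lpath a (rpath x b).

Lemma lpathM a x y : lpath a x ** y = lpath a (x ** y).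
Proof. by elim: a => //= e a IH; rewrite -nmulA IH. Qed.

Lemma rpathM b x y : x ** rpath y b = rpath (x ** y) b.
Proof. by elim: b => //= e b IH; rewrite nmulA IH. Qed.

Lemma lrpathC a b x : lpath a (rpath x b) = rpath (lpath a x) b.
Proof. by elim: b => //= e b IH; rewrite -IH lpathM. Qed.

Lemma rpath0 b : rpath 0 b = 0.
Proof. by elim: b => //= e b ->; rewrite nmul0l. Qed.

Lemma sandwich_cat p q a b x :
  sandwich (p ++ a) (q ++ b) x = sandwich p q (sandwich a b x).
Proof.
rewrite /sandwich /lpath /rpath !foldr_cat -/(rpath _ b) -/(rpath _ q).
by rewrite -/(lpath _ _) -/(lpath _ _) lrpathC.
Qed.

Lemma sandwich_cons e a f b x :
  sandwich (e :: a) (f :: b) x = S e ** (sandwich a b x ** T f).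
Proof. exact: (sandwich_cat [:: e] [:: f]). Qed.

Lemma sandwich_lin a b k x y :
  sandwich a b (k *: x + y) = k *: sandwich a b x + sandwich a b y.
Proof.
rewrite /sandwich; have -> : rpath (k *: x + y) b = k *: rpath x b + rpath y b.
  by elim: b => //= e b ->; rewrite nmulDl nmulZl.
by elim: a => //= e a ->; rewrite nmulDr nmulZr.
Qed.

Definition monomials : set B := [set m | exists a b v, m = sandwich a b (P v)].

Definition monomials_of g : set B :=
  [set m | exists a b v, degree a b = g /\ m = sandwich a b (P v)].

Definition diagonal n : set B :=
  [set m | exists c v, (size c <= n)%N /\ m = sandwich c c (P v)].

(** The vertex is [v] if [a] is empty and the source of its first edge if not. *)
Lemma monomial_source a b v : exists u0, forall u,
  P u ** sandwich a b (P v) = if u == u0 then sandwich a b (P v) else 0.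
Proof.
case: a => [|e a]; [exists v|exists (src e)] => u.
  rewrite /sandwich /= rpathM family_PP; case: eqP => // _.
  by rewrite rpath0.
by rewrite /sandwich /= nmulA family_PS; case: eqP; rewrite ?nmul0l.
Qed.

Lemma monomial_target a b v : exists u0, forall u,
  sandwich a b (P v) ** P u = if u == u0 then sandwich a b (P v) else 0.
Proof.
rewrite /sandwich lrpathC; case: b => [|e b]; [exists v|exists (src e)] => u.
  rewrite /= lpathM family_PP eq_sym; case: eqP => [->|_] //.
  by elim: a => //= e a ->; rewrite nmul0r.
by rewrite /= -nmulA family_TP eq_sym; case: eqP; rewrite ?nmul0r.
Qed.

Lemma diagonal_corner n u w x :
  lspan (diagonal n) x -> lspan (diagonal n) (P u ** (x ** P w)).
Proof.
apply: (lspan_map (f := fun x => P u ** (x ** P w))) => {x} [k x y|_ [c [v [hc ->]]]].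
  by rewrite nmulDl nmulZl nmulDr nmulZr.
have [w0 ->] := monomial_target c c v.
case: ifP => _; last by rewrite nmul0r; apply: lspan0.
have [u0 ->] := monomial_source c c v; case: ifP => _; last exact: lspan0.
by apply: lspan_gen; exists c, v.
Qed.

(** Compression by an edge shortens diagonal monomials; this drives the
induction on path length. *)
Lemma diagonal_compress n e x :
  lspan (diagonal n.+1) x -> lspan (diagonal n) (T e ** (x ** S e)).
Proof.
apply: (lspan_map (f := fun x => T e ** (x ** S e))) => {x} [k x y|_ [c [v [hc ->]]]].
  by rewrite nmulDl nmulZl nmulDr nmulZr.
case: c hc => [|f c] hc.
  rewrite /sandwich /= family_PS; case: ifP; rewrite ?nmul0r => _; last exact: lspan0.
  by rewrite (lf_ge F); apply: lspan_gen; exists [::], (tgt e).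
rewrite sandwich_cons -!nmulA family_TS.
have [->|_] := eqVneq f e; last by rewrite !nmul0r; apply: lspan0.
rewrite nmulA (lf_ge F); apply: diagonal_corner.
by apply: lspan_gen; exists c, v.
Qed.

Local Notation M := (lspan monomials).

Lemma monomials_mull y :
  (forall a b v, M (y ** sandwich a b (P v))) -> forall x, M x -> M (y ** x).
Proof.
move=> h; apply: (lspan_map (f := fun x => y ** x)) => [k x z|_ [a [b [v ->]]]] //.
by rewrite nmulDr nmulZr.
Qed.

Lemma monomials_mulP u x : M x -> M (P u ** x).
Proof.
apply: monomials_mull => a b v; have [u0 ->] := monomial_source a b v.
by case: ifP => _; [apply: lspan_gen; exists a, b, v|apply: lspan0].
Qed.

Lemma monomials_mulS e x : M x -> M (S e ** x).
Proof. by apply: monomials_mull => a b v; apply: lspan_gen; exists (e :: a), b, v. Qed.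

Lemma monomials_mulT e x : M x -> M (T e ** x).
Proof.
apply: monomials_mull => -[|f a] b v.
  rewrite /sandwich /= rpathM family_TP; case: ifP => _; last first.
    by rewrite rpath0; apply: lspan0.
  apply: lspan_gen; exists [::], (rcons b e), (tgt e).
  by rewrite /sandwich /rpath /= foldr_rcons (lf_rg F).
rewrite /sandwich /= nmulA family_TS -/(sandwich a b _).
case: ifP => _; last by rewrite nmul0l; apply: lspan0.
by apply: monomials_mulP; apply: lspan_gen; exists a, b, v.
Qed.

(** Sums of finitely many vertices are local units.  The claim covers every
larger set of vertices, so that it passes to linear combinations. *)
Lemma monomial_local_unit x : lspan monomials x -> exists l : seq (vertex E),
  forall l', uniq l' -> {subset l <= l'} ->
  (\sum_(v <- l') P v) ** x = x /\ x ** (\sum_(v <- l') P v) = x.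
Proof.
move: x; apply: lspan_ind => [|k _ y [a [b [v ->]]] [l hl]] /=.
  by exists [::] => l' _ _; rewrite nmul0l nmul0r.
have [u0 hu] := monomial_source a b v; have [w0 hw] := monomial_target a b v.
exists [:: u0, w0 & l] => l' ul' sl'.
have [|h1 h2] := hl l' ul'; first by move=> z hz; apply: sl'; rewrite !inE hz !orbT.
have U : (\sum_(v <- l') P v) ** sandwich a b (P v) = sandwich a b (P v).
  rewrite nmul_suml; under eq_bigr do rewrite hu.
  rewrite (bigD1_seq u0) /= ?eqxx // ?big1 ?addr0 // => [u /negbTE -> //|].
  by apply: sl'; rewrite inE eqxx.
have W : sandwich a b (P v) ** (\sum_(v <- l') P v) = sandwich a b (P v).
  rewrite nmul_sumr; under eq_bigr do rewrite hw.
  rewrite (bigD1_seq w0) /= ?eqxx // ?big1 ?addr0 // => [u /negbTE -> //|].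
  by apply: sl'; rewrite !inE eqxx orbT.
by rewrite nmulDr nmulDl nmulZl nmulZr U W h1 h2.
Qed.

Lemma corner_eq0 x : lspan monomials x ->
  (forall u w, P u ** (x ** P w) = 0) -> x = 0.
Proof.
move=> /monomial_local_unit[l hl] h0.
have [|h1 h2] := hl (undup l) (undup_uniq l); first by move=> z; rewrite mem_undup.
rewrite -h1 -h2 nmul_sumr nmul_suml big1 // => u _.
by rewrite nmul_sumr big1.
Qed.

(** Up to a multiple of [v], the part at [v] of a diagonal element lives under
finitely many edges: [k] is the total coefficient of [v], and [l] collects
the first edges of the other monomials.  As for local units, the claim for all
larger [l'] is what makes it pass to linear combinations. *)
Lemma diagonal_split n v y : lspan (diagonal n) y -> exists k (l : seq (edge E)),
  forall l', uniq l' -> {subset l <= l'} ->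
  let z := P v ** y - k *: P v in
  z = \sum_(e <- l') S e ** (T e ** (z ** S e)) ** T e.
Proof.
move: y; apply: lspan_ind => [|j _ y [c [w [_ ->]]] [k [l hl]]] /=.
  exists 0, [::] => l' _ _; rewrite nmul0r scale0r subr0 big1 // => e _.
  by rewrite nmul0l !nmul0r nmul0l.
have [k0 [l0 h0]] : exists k0 (l0 : seq (edge E)),
    forall l', uniq l' -> {subset l0 <= l'} ->
    let z := P v ** sandwich c c (P w) - k0 *: P v in
    z = \sum_(e <- l') S e ** (T e ** (z ** S e)) ** T e.
  case: c => [|f c].
    exists (v == w)%:R, [::] => l' _ _ z.
    have -> : z = 0.
      rewrite /z /sandwich /= family_PP.
      by case: eqP => [->|_]; rewrite ?scale1r ?scale0r ?subrr.
    by rewrite big1 // => e _; rewrite nmul0l !nmul0r nmul0l.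
  exists 0, [:: f] => l' ul' sl' z.
  rewrite (bigD1_seq f) //=; last by apply: sl'; rewrite inE.
  have zE : z = if v == src f then S f ** sandwich c c (P w) ** T f else 0.
    rewrite /z scale0r subr0 sandwich_cons.
    by rewrite !nmulA family_PS; case: eqP; rewrite ?nmul0l // nmulA.
  rewrite big1 ?addr0; last first.
    move=> e /negbTE ef; rewrite zE; case: ifP => _; rewrite ?nmul0l ?nmul0r ?nmul0l //.
    by rewrite !nmulA -!nmulA (nmulA (T e)) family_TS ef !nmul0l !nmul0r.
  rewrite zE; case: ifP => _; last by rewrite nmul0l !nmul0r nmul0l.
  rewrite -!nmulA !(nmulA (T f) (S f)) (lf_ge F) (lf_rg F).
  by rewrite (nmulA (S f) (P _)) (lf_er F).
exists (j * k0 + k), (l0 ++ l) => l' ul' sl'.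
have /(h0 l' ul') /= e0 : {subset l0 <= l'}.
  by move=> e he; apply: sl'; rewrite mem_cat he.
have /(hl l' ul') /= e1 : {subset l <= l'}.
  by move=> e he; apply: sl'; rewrite mem_cat he orbT.
have -> : P v ** (j *: sandwich c c (P w) + y) - (j * k0 + k) *: P v =
    j *: (P v ** sandwich c c (P w) - k0 *: P v) + (P v ** y - k *: P v).
  by rewrite nmulDr nmulZr scalerDl opprD scalerBr scalerA addrACA.
move: (_ - k0 *: _) (_ - k *: _) e0 e1 => z0 z1 e0 e1.
rewrite {1}e0 {1}e1 scaler_sumr -big_split /=; apply: eq_bigr => e _.
by rewrite !nmulDl nmulZl !nmulDr !nmulZr nmulDl nmulZl.
Qed.

Section Injectivity.
Variables (A : nuAlgType K) (psi : B -> A).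
Hypotheses (psiH : nualg_hom psi) (psiP : forall v, psi (P v) <> 0).

(** If [v] has an edge [e] outside [l], then [e^* (v - sum) e] is the vertex
[tgt e], and if [l] is empty the defect is [v] itself, so in both cases [psi] does
not kill the defect unless it kills a vertex; otherwise [l] is the
set of all edges leaving [v], and the defect vanishes. *)
Lemma vertex_defect_injective v k (l : seq (edge E)) :
  uniq l -> (forall e, e \in l -> src e = v) ->
  psi (k *: (P v - \sum_(e <- l) S e ** T e)) = 0 ->
  k *: (P v - \sum_(e <- l) S e ** T e) = 0.
Proof.
move=> ul sl; set d := P v - _; rewrite (homZ psiH) => /eqP.
rewrite scaler_eq0 => /orP[/eqP ->|/eqP pd0]; first by rewrite scale0r.
suff -> : d = 0 by rewrite scaler0.
have Td e : e \notin l -> src e = v -> T e ** (d ** S e) = P (tgt e).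
  move=> el ev; rewrite /d nmulDl -scaleN1r nmulZl nmul_suml big_seq big1.
    by rewrite scaler0 addr0 -ev (lf_se F) (lf_ge F).
  move=> f fl; rewrite -nmulA family_TS; case: eqP => [fe|]; last by rewrite nmul0r.
  by rewrite fe (negbTE el) in fl.
have all_in e : (e \in l) = (src e == v).
  apply/idP/eqP => [/sl //|ev]; apply: contrapT => /negP el.
  by apply: (psiP (v := tgt e)); rewrite -(Td e el ev) !(homM psiH) pd0 nmul0l nmul0r.
rewrite /d; case: (l =P [::]) => [l0|l0]; last first.
  by rewrite -(lf_ck2 F ul l0 all_in) subrr.
by case: (psiP (v := v)); rewrite -[RHS]pd0 /d l0 big_nil subr0.
Qed.

(** Induction on the length bound [n].  For [z = v y - k v] the induction
hypothesis gives [e^* z e = - k (e^* v e)], so [diagonal_split] turns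
[v y] into [k] times the defect of [v]. *)
Lemma diagonal_injective n y : lspan (diagonal n) y -> psi y = 0 -> y = 0.
Proof.
have monoD m : lspan (diagonal m) `<=` lspan monomials.
  move=> x; apply: (lspan_map (f := id)) => // _ [c [v [_ ->]]].
  by apply: lspan_gen; exists c, c, v.
have red m x : lspan (diagonal m) x -> (forall v, P v ** x = 0) -> x = 0.
  move=> /monoD hx h; apply: corner_eq0 hx _ => u w.
  by rewrite nmulA h nmul0l.
elim: n y => [|n IH] y hy y0; apply: red (hy) _ => v.
  have [k Pk] : exists k, P v ** y = k *: P v.
    move: y hy {y0}; apply: lspan_ind => [|j _ y [c [w [+ ->]]] [k hk]] /=.
      by exists 0; rewrite nmul0r scale0r.
    case: c => // _; exists (j * (v == w)%:R + k).
    rewrite nmulDr nmulZr hk scalerDl -scalerA.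
    congr (j *: _ + _); rewrite /sandwich /= family_PP.
    by case: eqP => [->|_]; rewrite ?scale1r ?scale0r.
  have := vertex_defect_injective (v := v) (k := k) (l := [::]).
  rewrite big_nil subr0 -Pk; apply=> //.
  by rewrite (homM psiH) y0 nmul0r.
have [k [l hl]] := diagonal_split v hy.
have /(hl _ (undup_uniq l)) : {subset l <= undup l} by move=> e; rewrite mem_undup.
set z := P v ** y - _ => /= zE.
have Tz e : T e ** (z ** S e) = - (k *: (T e ** (P v ** S e))).
  rewrite /z nmulDl nmulDr -scaleNr nmulZl nmulZr scaleNr -[RHS]add0r; congr (_ + _).
  rewrite !nmulA family_TP; case: ifP => _; last by rewrite !nmul0l.
  rewrite -nmulA; apply: IH; first exact: diagonal_compress.
  by rewrite !(homM psiH) y0 nmul0l nmul0r.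
pose l0 := [seq e <- undup l | src e == v].
have Py : P v ** y = k *: (P v - \sum_(e <- l0) S e ** T e).
  apply/eqP; rewrite -subr_eq0 scalerBr opprB addrA addrAC -/z addrC; apply/eqP.
  rewrite zE /l0 big_filter scaler_sumr [in X in X + _]big_mkcond -big_split /=.
  rewrite big1 // => e _; rewrite Tz family_PS eq_sym; case: ifP => _.
    rewrite (lf_ge F) -scaleNr nmulZr nmulZl (lf_er F) -scalerDl subrr scale0r //.
  by rewrite nmul0r scaler0 oppr0 nmul0r nmul0l addr0.
rewrite Py; apply: vertex_defect_injective.
- exact/filter_uniq/undup_uniq.
- by move=> e; rewrite mem_filter => /andP[/eqP].
- by rewrite -Py (homM psiH) y0 nmul0r.
Qed.

(** Multiplying by [e^*] on the left undoes multiplication by [e] up to the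
vertex [tgt e].  Injectivity is therefore carried along for all corners
[u y w], which absorb these vertices. *)
Lemma sandwich_injective p q y :
  (forall u w, psi (P u ** (y ** P w)) = 0 -> P u ** (y ** P w) = 0) ->
  forall u w, psi (P u ** (sandwich p q y ** P w)) = 0 ->
    P u ** (sandwich p q y ** P w) = 0.
Proof.
move=> hy; have hq : forall u w, psi (P u ** (rpath y q ** P w)) = 0 ->
    P u ** (rpath y q ** P w) = 0.
  elim: q => //= e q IH u w; rewrite -nmulA family_TP.
  case: eqP => _; last by rewrite !nmul0r.
  rewrite -(lf_rg F) (nmulA (rpath y q)) nmulA => h.
  rewrite IH ?nmul0l //.
  have -> : P u ** (rpath y q ** P (tgt e)) =
      P u ** (rpath y q ** P (tgt e)) ** T e ** S e.
    by rewrite -[RHS]nmulA (lf_ge F) -!nmulA (lf_vv F).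
  by rewrite (homM psiH) h nmul0l.
elim: p => //= e p IH u w; rewrite /sandwich /= -/(sandwich p q y) !nmulA family_PS.
case: eqP => _; last by rewrite !nmul0l.
rewrite -(lf_er F) -!nmulA => h; rewrite IH ?nmul0r //.
have -> : P (tgt e) ** (sandwich p q y ** P w) =
    T e ** (S e ** (P (tgt e) ** (sandwich p q y ** P w))).
  by rewrite !nmulA (lf_ge F) (lf_vv F).
by rewrite (homM psiH) h nmul0r.
Qed.

(** The uniqueness theorem for the grading by the free group. *)
Theorem homogeneous_injective g x :
  lspan (monomials_of g) x -> psi x = 0 -> x = 0.
Proof.
move=> hx x0; apply: (@corner_eq0 x).
  move: hx; apply: (lspan_map (f := id)) => // _ [a [b [v [_ ->]]]].
  by apply: lspan_gen; exists a, b, v.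
have factor : exists p q n y, lspan (diagonal n) y /\ x = sandwich p q y.
  case hg: (posneg (word g)) => [[p q]|].
    exists p, q; move: x hx {x0}; apply: lspan_ind => [|k _ y [a [b [v [ab ->]]]]] /=.
      exists 0%N, 0; split; first exact: lspan0.
      by rewrite -[0 in RHS](addNr 0) -scaleN1r sandwich_lin scaleN1r addNr.
    move=> [n [z [hz ->]]].
    have [p' [q' [c [+ -> ->]]]] := degree_factor a b.
    (* The longer of the two bounds is needed: diagonal spans are filtered by
       path length. *)
    rewrite ab hg => -[<- <-]; exists (maxn (size c) n), (k *: sandwich c c (P v) + z).
    split; last by rewrite sandwich_lin sandwich_cat.
    apply: lspan_cons; first by exists c, v; rewrite leq_maxl.
    move: z hz; apply: (lspan_map (f := id)) => // _ [d [w [hd ->]]].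
    by apply: lspan_gen; exists d, w; rewrite leq_max hd orbT.
  (* Degrees of monomials are of the form p q^-1, so here x = 0. *)
  exists [::], [::], 0%N, x; split=> //.
  move: x hx {x0}; apply: lspan_ind => [|k _ y [a [b [v [ab ->]]]]].
    exact: lspan0.
  by have [p [q [c []]]] := degree_factor a b; rewrite ab hg.
have [p [q [n [y [hy xE]]]]] := factor.
move=> u w; rewrite xE; apply: sandwich_injective => [u' w'|].
  by apply: diagonal_injective; apply: diagonal_corner hy.
by rewrite -xE !(homM psiH) x0 nmul0l nmul0r.
Qed.

End Injectivity.
End Family.

(** The span of the monomials is a left ideal containing the generators, hence
contains every term. *)
Lemma leavitt_span (K : fieldType) (E : digraph) (x : leavitt K E) :
  lspan (monomials (@lvertex K E) (@ledge K E) (@lghost K E)) x.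
Proof.
set M := lspan _; have F := leavitt_is_family K E.
have add t y' : lpi (TAdd t y') = lpi t + lpi y' :> leavitt K E by rewrite -lpiD.
have mul t y' : lpi (TMul t y') = nmul (lpi t) (lpi y') :> leavitt K E.
  by rewrite -lpiM.
have scale k t : lpi (TScale k t) = k *: lpi t :> leavitt K E by rewrite -lpiZ.
have zero : lpi (TZero K E) = 0 :> leavitt K E by [].
have left_ideal (t : lterm K E) y : M y -> M (nmul (lpi t) y).
  elim: t y => [v|e|e||t IHt u IHu|k t IHt|t IHt u IHu] y hy.
  - exact: monomials_mulP F _ _ hy.
  - exact: monomials_mulS hy.
  - exact: monomials_mulT F _ _ hy.
  - by rewrite zero nmul0l; apply: lspan0.
  - by rewrite add nmulDl; apply: lspanD; [apply: IHt|apply: IHu].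
  - by rewrite scale nmulZl; apply: lspanZ; apply: IHt.
  - by rewrite mul -nmulA; apply: IHt; apply: IHu.
elim/lpi_ind: x => t.
have gen v : M (lvertex K v) by apply: lspan_gen; exists [::], [::], v.
elim: t => [v|e|e||t IHt u IHu|k t IHt|t IHt u IHu].
- exact: gen.
- rewrite -/(ledge K e) -(lf_er F e); exact: left_ideal.
- rewrite -/(lghost K e) -(lf_gs F e); exact: left_ideal.
- by rewrite zero; apply: lspan0.
- by rewrite add; apply: lspanD.
- by rewrite scale; apply: lspanZ.
- by rewrite mul; apply: left_ideal.
Qed.

(** * Boundary paths *)

(** If no finite path from [v] ends in a sink, then some edge leads from [v] to a
vertex with the same property, and choosing such edges again and again gives an
infinite path. *)
Lemma boundary_from (E : digraph) (v : vertex E) :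
  exists x : boundary E, bsrc (bval x) = v.
Proof.
have build (x : bword E) : is_boundary x -> bsrc x = v ->
    exists x : boundary E, bsrc (bval x) = v.
  by move=> hx xv; exists (Boundary (asboolT hx)).
have [[w hw]|hv] := pselect (exists w, walk_to_sink v w).
  exact: (build (Fin v w)).
pose trapped (u : vertex E) := ~ exists w, walk_to_sink u w.
have step u : trapped u -> exists e, src e = u /\ trapped (tgt e).
  move=> hu; apply: contrapT => hN; apply: (hu); exists [::] => e eu.
  apply: hN; exists e; split=> // -[w hw]; apply: hu; exists (e :: w).
  by split.
have [e0 [e0v he0]] := step v hv.
have [e|nxt hnxt] := @choice _ _
    (fun e f => trapped (tgt e) -> src f = tgt e /\ trapped (tgt f)).
  have [/step[f hf]|he] := pselect (trapped (tgt e)); first by exists f.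
  (* The value at an edge with an untrapped target is arbitrary. *)
  by exists e0.
have tr i : trapped (tgt (iter i nxt e0)) by elim: i => //= i /hnxt[].
apply: (build (Inf (fun i => iter i nxt e0))) => //= i.
by rewrite /link; have [-> _] := hnxt _ (tr i).
Qed.

(** * The Leavitt family in the partial skew group ring *)

Section Skew.
Variables (K : fieldType) (E : digraph).
Implicit Types (p q r : free_group (edge E)) (e : edge E) (v : vertex E).
Implicit Types (x : boundary E).
Notation FX := (boundary E -> K^o).

Lemma one_gen e x : one_ K (gen e) x = (bhead (bval x) == Some e)%:R.
Proof.
rewrite one_E thetaE /= /lact /=; case: eqP => // h.
by have [y] := lact_neg h; rewrite /lact /= h eqxx => ->.
Qed.

Lemma one_genV e x : one_ K (gen e)^-1%g x = (bsrc (bval x) == tgt e)%:R.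
Proof.
rewrite one_E invgK thetaE /= /lact /=; case: eqP => // h.
by have [y] := lact_pos h; rewrite /lact /= h eqxx => ->.
Qed.

Lemma coef_delta p f (hf : D_ p f) r x :
  coef (delta hf : skew_ring K E) r x = if r == p then f x else 0.
Proof. by rewrite /= /delta_coef; case: ifP. Qed.

Lemma coef_deltaM p q f g (hf : D_ p f) (hg : D_ q g) r x :
  coef (nmul (delta hf) (delta hg) : skew_ring K E) r x =
  if r == (p * q)%g then f x * oapp g 0 (theta p^-1%g x) else 0.
Proof.
rewrite delta_mul coef_delta; case: ifP => // _.
by rewrite alpha_mulE //; case: theta.
Qed.

Lemma coef_sum I (s : seq I) (Q : pred I) (G : I -> skew_ring K E) r x :
  coef (\sum_(i <- s | Q i) G i) r x = \sum_(i <- s | Q i) coef (G i) r x.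
Proof. exact: (big_morph (fun z : skew_ring K E => coef z r x)). Qed.

Lemma theta_gen e x :
  (exists2 y, theta (gen e) x = Some y &
     bsrc (bval x) = tgt e /\ bval y = bcons e (bval x)) \/
  theta (gen e) x = None /\ bsrc (bval x) != tgt e.
Proof.
have -> : theta (gen e) x = lact (e, true) x by rewrite thetaE.
case h: lact => [y|]; first by left; exists y => //; apply/lact_posP.
by right; split=> //; apply/eqP => /lact_pos[y]; rewrite h.
Qed.

Lemma theta_genV e x :
  (exists2 y, theta (gen e)^-1%g x = Some y &
     bhead (bval x) = Some e /\ bval y = bbehead (bval x)) \/
  theta (gen e)^-1%g x = None /\ bhead (bval x) != Some e.
Proof.
have -> : theta (gen e)^-1%g x = lact (e, false) x by rewrite thetaE.
case h: lact => [y|]; first by left; exists y => //; apply/lact_negP.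
by right; split=> //; apply/eqP => /lact_neg[y]; rewrite h.
Qed.

Lemma coef_edge_ghost e r x :
  coef (nmul (skew_edge K e) (skew_ghost K e)) r x =
  if r == 1%g then (bhead (bval x) == Some e)%:R else 0.
Proof.
rewrite coef_deltaM mulgV one_gen; case: ifP => // _.
have [[y -> [h hy]]|[-> h]] := theta_genV e x; last by rewrite (negbTE h) mulr0.
by rewrite h eqxx mul1r /= one_genV hy (bsrc_behead (bvalP x) h) eqxx.
Qed.

Lemma skew_family :
  leavitt_family (@skew_vertex K E) (@skew_edge K E) (@skew_ghost K E).
Proof.
split=> [v|v w vw|e|e|e|e|e f ef|e|v l ul l0 hl]; apply: skew_ext => r x.
- rewrite coef_deltaM coef_delta mulg1; case: ifP => // _.
  by rewrite invg1 theta1 /= onevE; case: eqP; rewrite ?mulr1 ?mul0r.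
- rewrite coef_deltaM mulg1; case: ifP => // _.
  rewrite invg1 theta1 /= !onevE; case: eqP => [->|_]; last by rewrite mul0r.
  by case: eqP => // _; rewrite mulr0.
- rewrite coef_deltaM coef_delta mul1g; case: ifP => // _.
  rewrite invg1 theta1 /= onevE one_gen.
  by case: (bhead _ =P _) => [/(bsrc_head (bvalP x)) ->|]; rewrite ?eqxx ?mulr1 ?mulr0.
- rewrite coef_deltaM coef_delta mulg1; case: ifP => // _.
  rewrite one_gen; have [[y -> [h hy]]|[-> h]] := theta_genV e x.
    by rewrite /= onevE hy (bsrc_behead (bvalP x) h) eqxx mulr1.
  by rewrite (negbTE h) mulr0.
- rewrite coef_deltaM coef_delta mul1g; case: ifP => // _.
  rewrite invg1 theta1 /= onevE one_genV.
  by case: eqP; rewrite ?mulr1 ?mulr0.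
- rewrite coef_deltaM coef_delta mulg1; case: ifP => // _.
  rewrite one_genV invgK; have [[y -> [h hy]]|[-> h]] := theta_gen e x.
    by rewrite /= onevE hy bsrc_cons eqxx mulr1.
  by rewrite (negbTE h) mulr0.
- rewrite coef_deltaM; case: ifP => // _.
  rewrite invgK; have [[y -> [h hy]]|[-> h]] := theta_gen e x; last by rewrite mulr0.
  rewrite /= one_gen hy bhead_cons; case: eqP => [[fe]|_]; last by rewrite mulr0.
  by case: ef.
- rewrite coef_deltaM coef_delta mulVg; case: ifP => // _.
  rewrite one_genV onevE invgK; have [[y -> [h hy]]|[-> h]] := theta_gen e x.
    by rewrite /= one_gen hy bhead_cons eqxx mulr1.
  by rewrite (negbTE h) mulr0.
- rewrite coef_sum coef_delta; under eq_bigr do rewrite coef_edge_ghost.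
  case: ifP => _; last by rewrite big1.
  rewrite onevE; case: eqP => [xv|xv]; last first.
    rewrite big_seq big1 // => e; rewrite hl => /eqP ev; case: eqP => // h.
    by case: xv; rewrite (bsrc_head (bvalP x) h).
  case h: (bhead (bval x)) => [e|]; last first.
    case: l l0 hl {ul} => // e l _ /(_ e); rewrite inE eqxx => /esym /eqP ev.
    move: (bvalP x) xv h; case: (bval x) => [u [|//]|//] /= su uv _.
    by case: (su e); rewrite ev.
  have el : e \in l by rewrite hl -(bsrc_head (bvalP x) h) xv.
  rewrite (bigD1_seq e) //= eqxx big1 ?addr0 // => f.
  by rewrite eq_sym => /negbTE fe; case: eqP => // -[ef]; rewrite ef eqxx in fe.
Qed.

(** * Bijectivity *)

Section Homomorphism.
Variable psi : leavitt K E -> skew_ring K E.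
Hypotheses (psiH : nualg_hom psi)
  (psi_edge : forall e, psi (ledge K e) = skew_edge K e)
  (psi_ghost : forall e, psi (lghost K e) = skew_ghost K e)
  (psi_vertex : forall v, psi (lvertex K v) = skew_vertex K v).

Lemma vertex_neq0 v : psi (lvertex K v) <> 0.
Proof.
move=> v0; have [x xv] := boundary_from v.
have : coef (psi (lvertex K v)) 1%g x = 1.
  by rewrite psi_vertex coef_delta eqxx onevE xv eqxx.
by rewrite v0 => /eqP; rewrite eq_sym oner_eq0.
Qed.

Definition attained p (f : FX) := exists z (hf : D_ p f), psi z = delta hf.

Lemma attained_lin p (k : K) (f g : FX) :
  attained p f -> attained p g -> attained p (k *: f + g).
Proof.
move=> [z [hf zE]] [y [hg yE]]; exists (k *: z + y), (D_lin k hf hg).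
rewrite psiH.1 zE yE; apply: skew_ext => r x.
rewrite Defs.coefD Defs.coefZ !coef_delta; case: ifP => // _.
by rewrite scaler0 addr0.
Qed.

Lemma attained0 p : attained p 0.
Proof.
exists 0, (D_zero _ p); rewrite (hom0 psiH); apply: skew_ext => r x.
by rewrite coef_delta; case: ifP.
Qed.

Lemma attainedM p q f g : attained p f -> attained q g ->
  attained (p * q)%g (fun x => f x * oapp g 0 (theta p^-1%g x)).
Proof.
move=> [z [hf zE]] [y [hg yE]].
have -> : (fun x => f x * oapp g 0 (theta p^-1%g x)) =
    alpha p (alpha p^-1%g f * g).
  by apply/funext => x; rewrite alpha_mulE //; case: theta.
by exists (nmul z y), (alpha_D hf hg); rewrite (homM psiH) zE yE delta_mul.
Qed.

Lemma attained_edge e : attained (gen e) (one_ K (gen e)).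
Proof. by exists (ledge K e), (D_one K (edge_neq1 e)); rewrite psi_edge. Qed.

Lemma attained_ghost e : attained (gen e)^-1%g (one_ K (gen e)^-1%g).
Proof. by exists (lghost K e), (D_one K (ghost_neq1 e)); rewrite psi_ghost. Qed.

Lemma attained_vertex v : attained 1%g (onev K v).
Proof. by exists (lvertex K v), (D_onev K v); rewrite psi_vertex. Qed.

Lemma cylE v a x :
  (\1_(cyl v a) : FX) x = ((bsrc (bval x) == v) && starts a (bval x))%:R.
Proof.
rewrite indicE; congr (nat_of_bool _)%:R; apply/idP/idP.
  by rewrite inE => -[-> ->]; rewrite eqxx.
by case/andP => /eqP h1 h2; rewrite inE.
Qed.

(** [1_e delta_e (f delta_0) 1_(e^-1) delta_(e^-1)] is [f] transported by
[theta_e], and this takes the cylinder of [a] to that of [e :: a]. *)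
Lemma attained_cyl v a : attained 1%g (\1_(cyl v a)).
Proof.
elim: a v => [|e a IH] v; first by rewrite -Xv_cyl; apply: attained_vertex.
have [->|ve] := eqVneq v (src e); last first.
  suff -> : \1_(cyl v (e :: a)) = 0 :> FX by apply: attained0.
  apply/funext => x; rewrite cylE; case: eqP => //= xv.
  by case: eqP => //= /(bsrc_head (bvalP x)) xe; rewrite -xv xe eqxx in ve.
have := attainedM (attainedM (attained_edge e) (IH (tgt e))) (attained_ghost e).
rewrite mulg1 mulgV; congr (attained _); apply/funext => x.
rewrite cylE one_gen; have [[y -> [h hy]]|[-> h]] := theta_genV e x; last first.
  by rewrite /= (negbTE h) !mul0r andbF.
rewrite /= cylE one_genV hy h (bsrc_behead (bvalP x) h) (bsrc_head (bvalP x) h).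
by rewrite !eqxx !mulr1 mul1r.
Qed.

Lemma attained_D0 f : D0 f -> attained 1%g f.
Proof.
move: f; apply: lspan_ind => [|k f g hf hg] /=; first exact: attained0.
apply: attained_lin => //.
by have [->|[v [a ->]]] := gens_cyl hf; [apply: attained0|apply: attained_cyl].
Qed.

(** For a reduced word [l :: w], [1_l delta_l] times [1_w delta_w] has
coefficient [1_l 1_(l w) = 1_(l w)], because applying the inverse of [l w] starts
by applying the inverse of [l].  Words that are not of the form [a b^-1] give
zero on both sides. *)
Lemma attained_one p : p != 1%g -> attained p (one_ K p).
Proof.
case: p => w; elim: w => [|l w IH] hw p1; first by case/eqP: p1; apply: val_inj.
have hl : reduced [:: l] by [].
have al : attained (FreeGroup hl) (one_ K (FreeGroup hl)).
  case: (l) hl => e [] hl'.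
    have -> : FreeGroup hl' = gen e by apply: val_inj.
    exact: attained_edge.
  have -> : FreeGroup hl' = (gen e)^-1%g by apply: val_inj.
  exact: attained_ghost.
case: w IH hw p1 => [|k w] IH hw p1.
  by have -> : FreeGroup hw = FreeGroup hl by apply: val_inj.
have hw' := reduced_tl hw.
have := attainedM al (IH hw' isT).
have -> : (FreeGroup hl * FreeGroup hw')%g = FreeGroup hw.
  by apply: val_inj; exact: (wcons_noncancel hw).
congr (attained _); apply/funext => x; rewrite !one_E.
have -> : theta (FreeGroup hw)^-1%g x =
    obind (theta (FreeGroup hw')^-1%g) (theta (FreeGroup hl)^-1%g x).
  rewrite !thetaE -[word _]/(winv (l :: k :: w)) winv_cons -cats1 wact_cat.
  rewrite -[word _]/[:: linv l]; case: (wact [:: linv l] x) => //= y.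
  by rewrite thetaE.
by case: theta => [y|] /=; rewrite ?mul0r // mul1r one_E.
Qed.

Lemma attained_D p f : D_ p f -> attained p f.
Proof.
move=> hf; have [p1|p1] := eqVneq p 1%g.
  by rewrite p1 in hf *; apply: attained_D0; apply: D_D0 hf.
have := attainedM (attained_D0 (D_D0 hf)) (attained_one p1).
rewrite mul1g; congr (attained _); apply/funext => x; rewrite invg1 theta1 /=.
by rewrite -[in RHS](D_supp hf) mulrC.
Qed.

Lemma skew_surjective y : exists z, psi z = y.
Proof.
have Dy := (skewP y).2.
have [z zE] : exists z, psi z = \sum_(p <- supp (coef y)) delta (Dy p).
  elim: (enum_fset (supp (coef y))) => [|p s [z zE]].
    by exists 0; rewrite big_nil (hom0 psiH).
  have [w [hp wE]] := attained_D (Dy p).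
  exists (w + z); rewrite (homD psiH) zE wE big_cons; congr (_ + _).
  by apply: val_inj.
exists z; rewrite zE; apply: skew_ext => q x; rewrite coef_sum.
under eq_bigr do rewrite coef_delta.
have [qs|qs] := boolP (q \in supp (coef y)).
  rewrite (bigD1_seq q) ?fset_uniq //= eqxx big1 ?addr0 // => p.
  by rewrite eq_sym => /negbTE ->.
rewrite (suppP (skewP y) qs) big_seq big1 // => p ps.
by case: eqP => // qp; rewrite qp ps in qs.
Qed.

Definition homogeneous p (z : skew_ring K E) := exists f (hf : D_ p f), z = delta hf.

Lemma homogeneousM p q z y :
  homogeneous p z -> homogeneous q y -> homogeneous (p * q)%g (nmul z y).
Proof.
move=> [f [hf ->]] [g [hg ->]].
by exists (alpha p (alpha p^-1%g f * g)), (alpha_D hf hg); rewrite delta_mul.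
Qed.

(** This is what lets coefficients separate monomials of different degrees. *)
Lemma sandwich_homogeneous a b v :
  homogeneous (degree a b)
    (psi (sandwich (@ledge K E) (@lghost K E) a b (lvertex K v))).
Proof.
have hb : homogeneous (path_word b)^-1%g (psi (rpath (@lghost K E) (lvertex K v) b)).
  elim: b => [|e b IH] /=.
    by rewrite invg1 psi_vertex; exists (onev K v), (D_onev K v).
  rewrite invgM (homM psiH) psi_ghost; apply: homogeneousM => //.
  by exists (one_ K (gen e)^-1%g), (D_one K (ghost_neq1 e)).
rewrite /degree /sandwich; elim: a => [|e a IH] /=; first by rewrite mul1g.
rewrite -mulgA (homM psiH) psi_edge; apply: homogeneousM => //.
by exists (one_ K (gen e)), (D_one K (edge_neq1 e)).
Qed.

Lemma skew_injective : injective psi.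
Proof.
have ker0 (x : leavitt K E) : psi x = 0 -> x = 0.
  move=> x0; have [n [c [m [hm xE]]]] := leavitt_span x.
  pose mono ab v := sandwich (@ledge K E) (@lghost K E) ab.1 ab.2 (lvertex K v).
  have [i|w hw] := @choice _ _ (fun i w => m i = mono w.1 w.2).
    by have [a [b [v ->]]] := hm i; exists ((a, b), v).
  pose d i := degree (w i).1.1 (w i).1.2.
  rewrite xE; apply: (@eq0_by_fibre _ _ _ d) => g.
  apply: (homogeneous_injective (leavitt_is_family K E) psiH vertex_neq0 (g := g)).
    elim/big_rec: _ => [|i z /eqP dg hz]; first exact: lspan0.
    apply: lspan_cons => //; exists (w i).1.1, (w i).1.2, (w i).2.
    by split=> //; apply: hw.
  have off i r t : r != d i -> coef (psi (c i *: m i)) r t = 0.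
    move=> /negbTE ri; rewrite (homZ psiH) hw.
    have [f [hf ->]] := sandwich_homogeneous (w i).1.1 (w i).1.2 (w i).2.
    by rewrite Defs.coefZ coef_delta ri scaler0.
  apply: skew_ext => r t; rewrite (hom_sum psiH) coef_sum.
  have [->|rg] := eqVneq r g; last first.
    by rewrite big1 // => i /eqP di; rewrite off // di.
  transitivity (coef (psi x) g t); last by rewrite x0.
  rewrite xE (hom_sum psiH) coef_sum [RHS](bigID (fun i => d i == g)) /=.
  by rewrite [X in _ + X]big1 ?addr0 // => i di; rewrite off // eq_sym.
move=> x y xy; apply/eqP; rewrite -subr_eq0; apply/eqP/ker0.
by rewrite -scaleN1r (homD psiH) (homZ psiH) xy scaleN1r subrr.
Qed.

End Homomorphism.
End Skew.

Theorem theorem3p3 (K : fieldType) (E : digraph) :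
  exists phi : leavitt K E -> skew_ring K E,
    unique (fun psi : leavitt K E -> skew_ring K E =>
      [/\ nualg_hom psi,
          forall e : edge E, psi (ledge K e) = skew_edge K e,
          forall e : edge E, psi (lghost K e) = skew_ghost K e &
          forall v : vertex E, psi (lvertex K v) = skew_vertex K v]) phi /\
    bijective phi.
Proof.
have [phi [[phiH hv he hg] uniq_phi]] := leavitt_universal (skew_family K E).
exists phi; split.
  by split=> // psi [psiH pe pg pv]; apply: uniq_phi.
have [inv invK] := choice (skew_surjective phiH he hg hv).
by exists inv => // z; apply: (skew_injective phiH he hg hv); rewrite invK.
Qed.
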